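(* Let $X$ be a non-empty discrete proper metric space. (1) If $X$ has a combing of polynomial growth of order $m\in\mathbb{N}$, then for every $k\in\mathbb{R}_+$ the embedding of chain complexes $\mathscr{S}^{k+m}\tilde{C}_\bullet(X)\to\mathscr{S}^{k}\tilde{C}_\bullet(X)$ is homotopic to zero, via a bounded chain homotopy. (2) If $X$ has a combing of polynomial growth (of some order $m\in\mathbb{N}$), then $\mathscr{S}^\infty\tilde{C}_\bullet(X)$ is contractible. (3) If $X$ has a combing of subexponential growth, then $\mathscr{S}^\omega\tilde{C}_\bullet(X)$ is contractible. (4) If $X$ has a combing of exponential growth, then $\mathscr{O}\tilde{C}_\bullet(X)$ is contractible. Here a bornological chain complex is called contractible if it has a bounded contracting homotopy, that is, bounded linear maps $h_n$ of degree $1$ with $\delta h+h\delta=\mathrm{id}$.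
   Context: All vector spaces are real; $\mathbb{R}_+=[0,\infty)$. A bornology on a vector space $V$ is a collection of subsets, called bounded, such that subsets of bounded sets, finite sets, sums $S_1+S_2$ of bounded sets, and $\bigcup_{|t|\le\lambda}tS$ for $S$ bounded and $\lambda\in\mathbb{R}$ are bounded. All bornologies are complete and convex: every bounded subset is contained and bounded in some subspace $V_T$ with a Banach space norm for which $V_T\to V$ is bounded. A linear map is bounded if it maps bounded sets to bounded sets. A discrete metric space $(X,d)$ is proper if its bounded subsets are finite. Fix a base point $\star\in X$ and put $\ell(x)=d(x,\star)$. Function spaces. For $k\in\mathbb{R}_+$ let $\mathscr{S}^k(X)$ be the Banach space of $\phi\colon X\to\mathbb{R}$ with $\|\phi\|^k=\sum_{x}|\phi(x)|(\ell(x)+1)^k<\infty$, with the bornology of norm-bounded subsets. Let $\mathscr{S}^\infty(X)=\bigcap_{k\in\mathbb{N}}\mathscr{S}^k(X)$; a subset is bounded if it is bounded for each norm $\|\cdot\|^k$, $k\in\mathbb{N}$. For $\alpha>1$ let $|||\phi|||_\alpha=\sum_x|\phi(x)|\alpha^{\ell(x)}$. Let $\mathscr{O}(X)$ be the space of $\phi$ with $|||\phi|||_\alpha<\infty$ for all $\alpha>1$; a subset is bounded if it is bounded for every $|||\cdot|||_\alpha$. Let $\mathscr{S}^\omega(X)$ be the space of $\phi$ with $|||\phi|||_\alpha<\infty$ for some $\alpha>1$; a subset is bounded if it is bounded for some $|||\cdot|||_\alpha$ with $\alpha>1$. Tempered chain complexes. Let $\mathscr{T}(X)$ be $\mathscr{O}(X)$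 or $\mathscr{S}^k(X)$ with $k\in\mathbb{R}_+\cup\{\infty,\omega\}$. For $R\in\mathbb{N}$ let $\mathscr{T}C_n(X)_R$ be the space of functions $\phi\colon X^{n+1}\to\mathbb{R}$ such that $\phi(x_0,\dots,x_n)=0$ whenever $d(x_i,x_j)>R$ for some $i,j$ or $x_j=x_{j+1}$ for some $j$, and such that the function $x\mapsto\sum_{x_1,\dots,x_n}|\phi(x,x_1,\dots,x_n)|$ belongs to $\mathscr{T}(X)$. A subset is bounded if the associated set of functions in $\mathscr{T}(X)$ is bounded. Let $\mathscr{T}C_n(X)=\bigcup_R\mathscr{T}C_n(X)_R$, where a subset is bounded if it is contained and bounded in some $\mathscr{T}C_n(X)_R$. The boundary map $\delta\colon\mathscr{T}C_n(X)\to\mathscr{T}C_{n-1}(X)$ is the bounded extension of $\delta(x_0,\dots,x_n)=\sum_{j=0}^n(-1)^j(x_0,\dots,\widehat{x_j},\dots,x_n)$, where a tuple $(x_0,\dots,x_n)$ denotes its characteristic function and tuples with two equal consecutive entries are regarded as $0$. The augmentation is $\alpha\colon\mathscr{T}C_0(X)=\mathscr{T}(X)\to\mathbb{R}$, $\alpha(\phi)=\sum_x\phi(x)$. The reduced complex $\mathscr{T}\tilde{C}_\bullet(X)$ has $\mathscr{T}\tilde{C}_0(X)=\ker\alpha$ and $\mathscr{T}\tilde{C}_n(X)=\mathscr{T}C_n(X)$ for $n\ge1$, with boundary map $\delta$. Combings. A combing on $X$ (with base point $\star$) is a sequence of maps $f_n\colon X\to X$, $n\in\mathbb{N}=\{0,1,2,\dots\}$,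 such that: for all $x\in X$, $f_0(x)=\star$ and there is $n$ with $f_N(x)=x$ for all $N\ge n$; there is $C>0$ with $d(f_n(x),f_n(y))\le C(d(x,y)+1)$ for all $x,y\in X$, $n\in\mathbb{N}$; there is $S\in\mathbb{N}$ with $d(f_n(x),f_{n+1}(x))\le S$ for all $x\in X$, $n\in\mathbb{N}$. Let $J(x)$ be the (finite) number of $n\in\mathbb{N}$ with $f_n(x)\ne f_{n+1}(x)$. The combing has polynomial growth of order $m\in\mathbb{N}$ if $J(x)\le C(\ell(x)+1)^m$ for some $C$ and all $x$; subexponential growth if for every $\alpha>1$ there is $C>0$ with $J(x)\le C\alpha^{\ell(x)}$ for all $x$; exponential growth if there are $C>0$, $\alpha>1$ with $J(x)\le C\alpha^{\ell(x)}$ for all $x$. *)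

(* Defs.v *)
(* MathComp-Analysis. *)
From HB Require Import structures.
From mathcomp Require Import all_boot all_order all_algebra finmap.
From mathcomp Require Import all_classical all_reals all_analysis.

Set Implicit Arguments.
Unset Strict Implicit.
Unset Printing Implicit Defensive.

Import Order.TTheory GRing.Theory Num.Theory.
Import numFieldNormedType.Exports.

Local Open Scope classical_set_scope.
Local Open Scope ring_scope.

(* A subspace of the space of all functions I -> R, together with the
   collection of its bounded subsets. *)
Record bornSpace (R : realType) (I : Type) := BornSpace {
  carrier : set (I -> R) ;
  bounded : set (set (I -> R)) }.

(* Maps out of a bornSpace are represented by functions on all of I -> R; only
   their values on the carrier matter. *)
Definition bounded_linear (R : realType) (I J : Type)
    (A : bornSpace R I) (B : bornSpace R J) (h : (I -> R) -> (J -> R)) : Prop :=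
  [/\ forall phi, carrier A phi -> carrier B (h phi),
      forall (a : R) phi psi, carrier A phi -> carrier A psi ->
        h (fun i => a * phi i + psi i) = (fun i => a * h phi i + h psi i) &
      forall S, bounded A S -> bounded B (h @` S)].

(* The sum of an absolutely summable family of real numbers. *)
Definition abs_sum (R : realType) (I : choiceType) (phi : I -> R) : R :=
  fine (\esum_(i in [set: I]) (Num.max (phi i) 0)%:E) -
  fine (\esum_(i in [set: I]) (Num.max (- phi i) 0)%:E).

Section MetricSpaces.
Variables (R : realType) (X : metricType R).

Definition discrete_metric : Prop := forall x : X, open [set x].

Definition metric_bounded (A : set X) : Prop :=
  exists M : R, forall x y, A x -> A y -> mdist x y <= M.

Definition proper_metric : Prop :=
  forall A : set X, metric_bounded A -> finite_set A.

Variable star : X.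

Definition len (x : X) : R := mdist x star.

Definition pol_norm (k : R) (phi : X -> R) : \bar R :=
  \esum_(x in [set: X]) (`|phi x| * (len x + 1) `^ k)%:E.

Definition exp_norm (a : R) (phi : X -> R) : \bar R :=
  \esum_(x in [set: X]) (`|phi x| * a `^ len x)%:E.

Definition Spol (k : R) : bornSpace R X := BornSpace
  [set phi | pol_norm k phi < +oo]%E
  [set S | exists M : R, forall phi, S phi -> (pol_norm k phi <= M%:E)%E].

Definition Sinfty : bornSpace R X := BornSpace
  [set phi | forall k : nat, (pol_norm k%:R phi < +oo)%E]
  [set S | forall k : nat, exists M : R, forall phi, S phi ->
     (pol_norm k%:R phi <= M%:E)%E].

Definition Oexp : bornSpace R X := BornSpace
  [set phi | forall a : R, 1 < a -> (exp_norm a phi < +oo)%E]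
  [set S | forall a : R, 1 < a -> exists M : R, forall phi, S phi ->
     (exp_norm a phi <= M%:E)%E].

Definition Somega : bornSpace R X := BornSpace
  [set phi | exists2 a : R, 1 < a & (exp_norm a phi < +oo)%E]
  [set S | exists2 a : R, 1 < a & exists M : R, forall phi, S phi ->
     (exp_norm a phi <= M%:E)%E].

Definition chain (n : nat) : Type := n.+1.-tuple X -> R.

Definition degenerate (n : nat) (x : n.+1.-tuple X) : bool :=
  [exists j : 'I_n, tnth x (widen_ord (leqnSn n) j) == tnth x (lift ord0 j)].

Definition controlled (n r : nat) (phi : chain n) : Prop :=
  forall x : n.+1.-tuple X,
    (exists i j, mdist (tnth x i) (tnth x j) > r%:R) -> phi x = 0.

Definition normalized (n : nat) (phi : chain n) : Prop :=
  forall x : n.+1.-tuple X, degenerate x -> phi x = 0.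

(* The sum has finite support for controlled phi if X is proper. *)
Definition marginal (n : nat) (phi : chain n) : X -> R :=
  fun x => \sum_(t \in [set: n.-tuple X]) `|phi [tuple of x :: t]|.

Definition TC_at (T : bornSpace R X) (n r : nat) :
    bornSpace R (n.+1.-tuple X) :=
  let C := [set phi : chain n |
    [/\ controlled r phi, normalized phi & carrier T (marginal phi)]] in
  BornSpace C [set S | S `<=` C /\ bounded T (@marginal n @` S)].

Definition TC (T : bornSpace R X) (n : nat) : bornSpace R (n.+1.-tuple X) :=
  BornSpace [set phi | exists r, carrier (TC_at T n r) phi]
            [set S | exists r, bounded (TC_at T n r) S].

Definition augmentation (phi : chain 0) : R :=
  abs_sum (fun x : X => phi [tuple x]).

Definition redTC (T : bornSpace R X) (n : nat) :
    bornSpace R (n.+1.-tuple X) :=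
  match n with
  | 0 => let K := [set phi : chain 0 |
                    carrier (TC T 0) phi /\ augmentation phi = 0] in
         BornSpace K [set S | S `<=` K /\ bounded (TC T 0) S]
  | n'.+1 => TC T n'.+1
  end.

Definition tuple_chain (n : nat) (x : n.+1.-tuple X) : chain n :=
  fun y => if degenerate x then 0 else (y == x)%:R.

Definition face (n : nat) (j : 'I_n.+2) (x : n.+2.-tuple X) : n.+1.-tuple X :=
  [tuple tnth x (lift j i) | i < n.+1].

Definition tuple_boundary (n : nat) (x : n.+2.-tuple X) : chain n :=
  fun y => \sum_(j < n.+2) (-1) ^+ j * tuple_chain (face j x) y.

(* The extension of tuple_boundary to phi = \sum_x phi x * (x), evaluated
   pointwise: for controlled phi, a proper X and a fixed y only finitely many x
   contribute. *)
Definition boundary (n : nat) (phi : chain n.+1) : chain n :=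
  fun y => \sum_(x \in [set: n.+2.-tuple X]) phi x * tuple_boundary x y.

(* [f] : A -> B is homotopic to zero by a bounded chain homotopy; the boundary
   map vanishes in degree 0. *)
Definition null_homotopic (A B : forall n, bornSpace R (n.+1.-tuple X))
    (f : forall n, chain n -> chain n) : Prop :=
  exists h : forall n, chain n -> chain n.+1,
    [/\ forall n, bounded_linear (A n) (B n.+1) (@h n),
        forall phi, carrier (A 0%N) phi -> boundary (h 0%N phi) = f 0%N phi &
        forall n phi, carrier (A n.+1) phi ->
          boundary (h n.+1 phi) \+ h n (boundary phi) = f n.+1 phi].

(* Both for identity maps and for the embeddings of one tempered complex into
   another, the underlying map of functions is the identity. *)
Definition embedding (n : nat) (phi : chain n) : chain n := phi.

Definition contractible (A : forall n, bornSpace R (n.+1.-tuple X)) : Prop :=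
  null_homotopic A A embedding.

Definition combing (f : nat -> X -> X) : Prop :=
  [/\ forall x, f 0%N x = star,
      forall x, exists n, forall N, (n <= N)%N -> f N x = x,
      exists2 C : R, 0 < C &
        forall x y n, mdist (f n x) (f n y) <= C * (mdist x y + 1) &
      exists S : nat, forall x n, mdist (f n x) (f n.+1 x) <= S%:R].

Definition jumps (f : nat -> X -> X) (x : X) : nat :=
  #|` fset_set [set n | f n x <> f n.+1 x]|%fset.

Definition poly_growth (m : nat) (f : nat -> X -> X) : Prop :=
  exists C : R, forall x, (jumps f x)%:R <= C * (len x + 1) ^+ m.

Definition subexp_growth (f : nat -> X -> X) : Prop :=
  forall a : R, 1 < a -> exists2 C : R, 0 < C &
    forall x, (jumps f x)%:R <= C * a `^ len x.

Definition exp_growth (f : nat -> X -> X) : Prop :=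
  exists C a : R, [/\ 0 < C, 1 < a &
    forall x, (jumps f x)%:R <= C * a `^ len x].

End MetricSpaces.

Arguments embedding {R X} n phi.

(* Main.v *)
Require Import Defs.
From mathcomp Require Import all_boot all_order all_algebra.
From mathcomp Require Import all_classical all_reals all_analysis.
From mathcomp Require Import finmap lra ring zify.

(**
Interpolating between the maps f_n and f_{n+1} of a combing f by prisms
gives on chains the operator
  D_n (x_0, .., x_k) =
    sum_j (-1)^j (f_n x_0, .., f_n x_j, f_{n+1} x_j, .., f_{n+1} x_k),
which is a chain homotopy between the maps induced by f_n and f_{n+1}. The
sum h of all the D_n telescopes: since f_0 is constant and every tuple is
eventually fixed, the boundary of h plus h of the boundary is the identity
minus the map induced by a constant. The latter is zero on the reduced complex:
in positive degree its values are degenerate, and in degree 0 it is the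
augmentation.

What has to be seen is that h makes sense on infinite chains and is bounded.
The j-th simplex of D_n is degenerate unless f_n x_j differs from f_{n+1} x_j,
so the number of nonzero terms of h on the tuple x is at most the sum of the
jump numbers J(x_j), and each of them starts at some f_n x_0, whose length is
at most D (l(x_0) + 1). For a weight w on X, the w-norm of the chain h(x) is
therefore at most a constant, which depends only on the diameter of x and on
its number of entries, times v(x_0), as soon as v dominates the products of J
by the weights w(f_n x). This relation between v and w is the definition
dominates. All four statements are instances of a single one,
combing_null_homotopic, by the dominating pairs
- v = (l + 1)^(k + m) and w = (l + 1)^k for growth of order m
  (dominates_pol),
- v = (b^D a)^l and w = b^l for jump numbers in O(a^l) (dominates_exp); for
  exponential growth b is arbitrary and a is given, for subexponential growth
  a = b can be taken with b^(D + 1) prescribed.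

The homotopy h is an infinite matrix indexed by tuples. Its rows, the chains
h(x), are finite, but infinitely many of them can meet a given simplex, so the
values of h on chains are absolutely convergent series. Fubini for abs_sum
gives the composition rule for such operators (kernel_op_assoc). The algebra
takes place on finite sequences and dually: for a functional F on sequences,
face_sum F and prism_sum f g F are the compositions of F with the boundary and
with the prism operator. In this form the prism identity
(prism_sum_homotopy) is a short induction on the sequence.
*)

Set Implicit Arguments.
Unset Strict Implicit.
Unset Printing Implicit Defensive.

Import Order.TTheory GRing.Theory Num.Theory.
Local Open Scope classical_set_scope.
Local Open Scope ring_scope.

(** * Absolutely summable families and kernel operators *)

Section AbsSum.
Variable R : realType.

(** The positive and negative parts of p - q differ from p and q by the same
nonnegative family, so they can be replaced by any other summable
decomposition. Additivity and Fubini for abs_sum follow from this. *)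
Lemma abs_sumB (I : choiceType) (p q : I -> R) :
  (forall i, 0 <= p i) -> (forall i, 0 <= q i) ->
  (\esum_(i in setT) (p i)%:E < +oo)%E ->
  (\esum_(i in setT) (q i)%:E < +oo)%E ->
  abs_sum (fun i => p i - q i) =
    fine (\esum_(i in setT) (p i)%:E) - fine (\esum_(i in setT) (q i)%:E).
Proof.
move=> p0 q0 ps qs; rewrite /abs_sum.
set u := (\esum_(i in _) (Num.max (p i - q i) 0)%:E)%E.
set v := (\esum_(i in _) (Num.max (- (p i - q i)) 0)%:E)%E.
have ufin : u \is a fin_num.
  rewrite ge0_fin_numE; last first.
    by apply: esum_ge0 => i _; rewrite lee_fin le_max lexx orbT.
  apply: le_lt_trans ps; apply: le_esum => i _; rewrite lee_fin ge_max p0 andbT.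
  by rewrite gerBl.
have vfin : v \is a fin_num.
  rewrite ge0_fin_numE; last first.
    by apply: esum_ge0 => i _; rewrite lee_fin le_max lexx orbT.
  apply: le_lt_trans qs; apply: le_esum => i _; rewrite lee_fin ge_max q0 andbT.
  by rewrite opprB gerBl.
have pfin : (\esum_(i in setT) (p i)%:E)%E \is a fin_num.
  by rewrite ge0_fin_numE// esum_ge0// => i _; rewrite lee_fin.
have qfin : (\esum_(i in setT) (q i)%:E)%E \is a fin_num.
  by rewrite ge0_fin_numE// esum_ge0// => i _; rewrite lee_fin.
apply/eqP; rewrite subr_eq addrAC eq_sym subr_eq; apply/eqP.
rewrite -!fineD//; congr fine; rewrite -!esumD//.
- apply: eq_esum => i _; rewrite -!EFinD; congr (_%:E).
  by case: (lerP 0 (p i - q i)) => h; [rewrite max_r|rewrite max_l]; lra.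
- by move=> i _; rewrite lee_fin le_max lexx orbT.
- by move=> i _; rewrite lee_fin.
- by move=> i _; rewrite lee_fin.
- by move=> i _; rewrite lee_fin le_max lexx orbT.
Qed.

Definition l1norm (I : choiceType) (phi : I -> R) : \bar R :=
  \esum_(i in setT) (`|phi i|)%:E.

Lemma esum_pos_part_fin (I : choiceType) (phi : I -> R) :
  (l1norm phi < +oo)%E -> (\esum_(i in setT) (Num.max (phi i) 0)%:E < +oo)%E.
Proof.
apply: le_lt_trans; apply: le_esum => i _.
by rewrite lee_fin ge_max ler_norm normr_ge0.
Qed.

Lemma l1normN (I : choiceType) (phi : I -> R) :
  l1norm (fun i => - phi i) = l1norm phi.
Proof. by apply: eq_esum => i _; rewrite normrN. Qed.

Lemma pos_partB (x : R) : x = Num.max x 0 - Num.max (- x) 0.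
Proof. by case: (lerP 0 x) => h; [rewrite max_r|rewrite max_l]; lra. Qed.

Lemma pos_part_ge0 (x : R) : 0 <= Num.max x 0.
Proof. by rewrite le_max lexx orbT. Qed.

Lemma abs_sumD (I : choiceType) (phi psi : I -> R) :
  (l1norm phi < +oo)%E -> (l1norm psi < +oo)%E ->
  abs_sum (fun i => phi i + psi i) = abs_sum phi + abs_sum psi.
Proof.
move=> phis psis.
have s1 := esum_pos_part_fin phis; have s2 := esum_pos_part_fin psis.
rewrite -l1normN in phis; rewrite -l1normN in psis.
have s3 := esum_pos_part_fin phis; have s4 := esum_pos_part_fin psis.
have nn (f : I -> R) i : setT i -> (0 <= (Num.max (f i) 0)%:E)%E.
  by rewrite lee_fin pos_part_ge0.
have fn (f : I -> R) : (\esum_(i in setT) (Num.max (f i) 0)%:E < +oo)%E ->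
    (\esum_(i in setT) (Num.max (f i) 0)%:E)%E \is a fin_num.
  by move=> h; rewrite ge0_fin_numE// esum_ge0// => i; exact: nn.
have DE (f g : I -> R) : (\esum_(i in setT) (Num.max (f i) 0)%:E < +oo)%E ->
    (\esum_(i in setT) (Num.max (g i) 0)%:E < +oo)%E ->
   (\esum_(i in setT) (Num.max (f i) 0 + Num.max (g i) 0)%:E =
    \esum_(i in setT) (Num.max (f i) 0)%:E + \esum_(i in setT) (Num.max (g i) 0)%:E)%E.
  by move=> hf hg; rewrite -esumD//; exact: nn.
transitivity (abs_sum (fun i => (Num.max (phi i) 0 + Num.max (psi i) 0) -
  (Num.max (- phi i) 0 + Num.max (- psi i) 0))).
  congr abs_sum; apply/funext => i.
  by rewrite {1}(pos_partB (phi i)) {1}(pos_partB (psi i)); lra.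
rewrite abs_sumB.
- rewrite !DE// !fineD ?fn//.
  by rewrite /abs_sum opprD addrACA.
- by move=> i; rewrite addr_ge0 ?pos_part_ge0.
- by move=> i; rewrite addr_ge0 ?pos_part_ge0.
- by rewrite DE// lte_add_pinfty.
- by rewrite DE// lte_add_pinfty.
Qed.

Lemma esumZl (I : choiceType) (c : R) (a : I -> \bar R) : 0 <= c ->
  (forall i, 0 <= a i)%E ->
  (\esum_(i in setT) (c%:E * a i) = c%:E * \esum_(i in setT) a i)%E.
Proof.
have le (d : R) (b : I -> \bar R) : 0 <= d -> (forall i, 0 <= b i)%E ->
    (\esum_(i in setT) (d%:E * b i) <= d%:E * \esum_(i in setT) b i)%E.
  move=> d0 b0; apply: ge_ereal_sup => /= _ [A [finA _] <-].
  rewrite -ge0_mule_fsumr// lee_wpmul2l ?lee_fin//.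
  by apply: ereal_sup_ubound; exists A.
move=> c0 a0; apply/eqP; rewrite eq_le le//=.
(* the other inequality is the first one for the inverse of c *)
have [->|cn0] := eqVneq c 0.
  by rewrite mul0e esum_ge0// => i _; rewrite mul0e.
have := le c^-1 (fun i => c%:E * a i)%E.
rewrite invr_ge0 => /(_ c0); under eq_esum do rewrite muleA -EFinM mulVf// mul1e.
have h : (forall i, 0 <= c%:E * a i)%E by move=> i; rewrite mule_ge0// lee_fin.
move=> /(_ h) {}le; have := lee_wpmul2l (_ : 0 <= c%:E)%E le.
by rewrite lee_fin muleA -EFinM mulfV// mul1e; apply.
Qed.

Lemma abs_sumZ (I : choiceType) (c : R) (phi : I -> R) :
  abs_sum (fun i => c * phi i) = c * abs_sum phi.
Proof.
have nn (f : I -> R) : (0 <= \esum_(i in setT) (Num.max (f i) 0)%:E)%E.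
  by apply: esum_ge0 => i _; rewrite lee_fin pos_part_ge0.
have ZE (d : R) (f : I -> R) : 0 <= d ->
    fine (\esum_(i in setT) (Num.max (d * f i) 0)%:E) =
    d * fine (\esum_(i in setT) (Num.max (f i) 0)%:E).
  move=> d0; transitivity (fine (\esum_(i in setT) (d%:E * (Num.max (f i) 0)%:E)))%E.
    congr fine; apply: eq_esum => i _; rewrite -EFinM maxr_pMr ?mulr0//.
  rewrite esumZl//; last by move=> i; rewrite lee_fin pos_part_ge0.
  by case: (\esum_(i in setT) _)%E (nn f) => [r||]//= _;
     rewrite ?mulr0 //; have [->|d1] := eqVneq d 0;
     rewrite ?mul0e ?mul0r// gt0_muley ?mulr0// lte_fin lt0r d1.
have [c0|c0] := lerP 0 c; rewrite /abs_sum.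
  under [in X in _ - fine X]eq_esum do rewrite -mulrN.
  by rewrite (ZE c phi) // (ZE c (fun i => - phi i)) // mulrBr.
under [in X in fine X - _]eq_esum do rewrite -mulrNN.
under [in X in _ - fine X]eq_esum do rewrite -mulNr.
rewrite (ZE (- c) (fun i => - phi i)) ?(ZE (- c) phi) ?oppr_ge0 ?ltW//.
by rewrite !mulNr opprK addrC mulrBr.
Qed.

Lemma le_norm_abs_sum (I : choiceType) (phi : I -> R) :
  ((`|abs_sum phi|)%:E <= l1norm phi)%E.
Proof.
have nn (f : I -> R) : (0 <= \esum_(i in setT) (Num.max (f i) 0)%:E)%E.
  by apply: esum_ge0 => i _; rewrite lee_fin pos_part_ge0.
apply: (@le_trans _ _ (\esum_(i in setT) (Num.max (phi i) 0)%:E +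
   \esum_(i in setT) (Num.max (- phi i) 0)%:E)%E); last first.
  rewrite -esumD; try by move=> i _; rewrite lee_fin pos_part_ge0.
  apply: le_esum => i _; rewrite -EFinD lee_fin.
  case: (lerP 0 (phi i)) => h; rewrite ?(ger0_norm h) ?(ltr0_norm h).
    by rewrite max_r ?addr0// oppr_le0.
  by rewrite max_l ?add0r// oppr_ge0 ltW.
have := nn phi; have := nn (fun i => - phi i).
rewrite /abs_sum; case: (\esum_(i in setT) (Num.max (- phi i) 0)%:E)%E => [b||]//;
  case: (\esum_(i in setT) (Num.max (phi i) 0)%:E)%E => [a||]//=;
  rewrite ?lee_fin ?leey//.
by move=> b0 a0; rewrite ler_norml; lra.
Qed.

Lemma exchange_esum (I J : choiceType) (a : I -> J -> \bar R) :
  (forall i j, 0 <= a i j)%E ->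
  (\esum_(i in setT) \esum_(j in setT) a i j =
   \esum_(j in setT) \esum_(i in setT) a i j)%E.
Proof.
move=> a0; rewrite !esum_esum//.
rewrite (reindex_esum ([set: J] `*`` fun=> setT) _ (fun x => (x.2, x.1)))//=.
split => //=; first by move=> [i1 i2] [j1 j2] /= _ _ [] -> ->.
by move=> [i1 i2] _ /=; exists (i2, i1).
Qed.

(** Fubini: abs_sum is a difference of two sums of nonnegative terms, and these can
be exchanged unconditionally. *)
Lemma exchange_abs_sum (I J : choiceType) (a : I -> J -> R) :
  (\esum_(i in setT) l1norm (a i) < +oo)%E ->
  abs_sum (fun i => abs_sum (fun j => a i j)) =
  abs_sum (fun j => abs_sum (fun i => a i j)).
Proof.
have main (I' J' : choiceType) (b : I' -> J' -> R) :
    (\esum_(i in setT) l1norm (b i) < +oo)%E ->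
  abs_sum (fun i => abs_sum (fun j => b i j)) =
  fine (\esum_(i in setT) \esum_(j in setT) (Num.max (b i j) 0)%:E) -
  fine (\esum_(i in setT) \esum_(j in setT) (Num.max (- b i j) 0)%:E).
  move=> bs.
  have bi i : (l1norm (b i) < +oo)%E.
    apply: le_lt_trans bs; apply: esum_ge.
    by exists [set i]; [split|rewrite fsbig_set1].
  have fn (f : J' -> R) : (l1norm f < +oo)%E ->
    (\esum_(j in setT) (Num.max (f j) 0)%:E =
     (fine (\esum_(j in setT) (Num.max (f j) 0)%:E))%:E)%E.
    move=> /esum_pos_part_fin h; rewrite fineK// ge0_fin_numE//.
    by apply: esum_ge0 => j _; rewrite lee_fin pos_part_ge0.
  have bNi i : (l1norm (fun j => (- b i j)%R) < +oo)%E by rewrite l1normN.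
  transitivity (abs_sum (fun i => fine (\esum_(j in setT) (Num.max (b i j) 0)%:E) -
      fine (\esum_(j in setT) (Num.max (- b i j) 0)%:E))) => //.
  rewrite abs_sumB.
  - congr (fine _ - fine _); apply: eq_esum => i _; rewrite -fn//.
  - by move=> i; apply/fine_ge0/esum_ge0 => j _; rewrite lee_fin pos_part_ge0.
  - by move=> i; apply/fine_ge0/esum_ge0 => j _; rewrite lee_fin pos_part_ge0.
  - apply: le_lt_trans bs; apply: le_esum => i _; rewrite -fn//.
    by apply: le_esum => j _; rewrite lee_fin ge_max ler_norm normr_ge0.
  - apply: le_lt_trans bs; apply: le_esum => i _; rewrite -fn//.
    by apply: le_esum => j _; rewrite lee_fin ge_max -normrN ler_norm normr_ge0.
move=> aS; rewrite !main//; last first.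
  by rewrite /l1norm -exchange_esum// => i j; rewrite lee_fin.
by congr (fine _ - fine _); apply: exchange_esum => i j;
  rewrite lee_fin pos_part_ge0.
Qed.

Lemma abs_sum0 (I : choiceType) : abs_sum (fun _ : I => 0) = 0 :> R.
Proof.
by rewrite /abs_sum !esum1 ?subrr// => i _; rewrite ?oppr0 maxxx.
Qed.

Lemma abs_sum_delta (I : choiceType) (t : I) (phi : I -> R) :
  abs_sum (fun i => (i == t)%:R * phi i) = phi t.
Proof.
have E (f : I -> R) : (\esum_(i in setT) (Num.max ((i == t)%:R * f i) 0)%:E =
    (Num.max (f t) 0)%:E)%E.
  rewrite (esumID [set t]); last by move=> i _; rewrite lee_fin pos_part_ge0.
  rewrite setTI esum_set1 ?lee_fin ?pos_part_ge0// eqxx mul1r esum1 ?adde0//.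
  by move=> i [_ /= /eqP/negPf ->]; rewrite mul0r maxxx.
rewrite /abs_sum E; under [in X in _ - fine X]eq_esum do rewrite -mulrN.
by rewrite (E (fun i => - phi i)) /= -pos_partB.
Qed.

Lemma l1norm_delta (I : choiceType) (t : I) (phi : I -> R) :
  (l1norm (fun i => ((i == t)%:R * phi i)%R) = (`|phi t|)%:E)%E.
Proof.
rewrite /l1norm (esumID [set t]); last by move=> i _; rewrite lee_fin.
rewrite setTI esum_set1 ?lee_fin// eqxx mul1r esum1 ?adde0//.
by move=> i [_ /= /eqP/negPf ->]; rewrite mul0r normr0.
Qed.

Lemma le_l1normD (I : choiceType) (phi psi : I -> R) :
  (l1norm (fun i => (phi i + psi i)%R) <= l1norm phi + l1norm psi)%E.
Proof.
rewrite -esumD; try by move=> i _; rewrite lee_fin.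
by apply: le_esum => i _; rewrite -EFinD lee_fin ler_normD.
Qed.

Lemma le_l1norm_sum (I : choiceType) (K : Type) (r : seq K) (phi : K -> I -> R) :
  (l1norm (fun i => (\sum_(k <- r) phi k i)%R) <= \sum_(k <- r) l1norm (phi k))%E.
Proof.
elim: r => [|k r IH].
  by rewrite big_nil /l1norm esum1// => i _; rewrite big_nil normr0.
rewrite big_cons; under [X in l1norm X]eq_fun do rewrite big_cons.
by apply: le_trans (le_l1normD _ _) _; rewrite leeD2l.
Qed.

Lemma abs_sum_sum (I : choiceType) (K : Type) (r : seq K) (phi : K -> I -> R) :
  (forall k, l1norm (phi k) < +oo)%E ->
  abs_sum (fun i => \sum_(k <- r) phi k i) = \sum_(k <- r) abs_sum (phi k).
Proof.
move=> phis; elim: r => [|k r IH].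
  by rewrite big_nil; under [X in abs_sum X]eq_fun do rewrite big_nil; exact: abs_sum0.
rewrite big_cons; under [X in abs_sum X]eq_fun do rewrite big_cons.
rewrite abs_sumD// ?IH//; apply: le_lt_trans (le_l1norm_sum _ _) _.
elim: {IH} r => [|l r IH]; first by rewrite big_nil ltry.
by rewrite big_cons lte_add_pinfty.
Qed.

(** This makes the finite sums that define the boundary accessible to Fubini. *)
Lemma abs_sum_finite (I : choiceType) (A : set I) (phi : I -> R) :
  finite_set A -> (forall i, ~ A i -> phi i = 0) ->
  \sum_(i \in [set: I]) phi i = abs_sum phi.
Proof.
move=> finA phi0; have mA i : (i \in fset_set A) = (i \in A).
  by rewrite in_fset_set.
rewrite (fsbigE (fset_set A : seq I)) ?fset_uniq//; last first.
  by move=> i _; rewrite mA notin_setE => /phi0.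
rewrite (eq_bigl predT); last by move=> i; rewrite in_setT.
transitivity (abs_sum (fun i => \sum_(k <- fset_set A) (i == k)%:R * phi i)).
  rewrite abs_sum_sum => [|k]; last by rewrite l1norm_delta ltry.
  by apply: eq_bigr => k _; rewrite abs_sum_delta.
congr abs_sum; apply/funext => i; have [Ai|nAi] := pselect (A i).
  rewrite (bigD1_seq i) ?fset_uniq ?mA ?mem_set//= eqxx mul1r big1 ?addr0// => k.
  by rewrite eq_sym => /negPf ->; rewrite mul0r.
by rewrite phi0// big1// => k _; rewrite mulr0.
Qed.

Definition kernel_op (I J : choiceType) (K : I -> J -> R) (phi : I -> R) : J -> R :=
  fun j => abs_sum (fun i => phi i * K i j).

(** This reduces the boundedness of a kernel operator to estimates for single rows. *)
Lemma le_kernel_op (I J : choiceType) (K : I -> J -> R) (w : J -> R)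
    (phi : I -> R) : (forall j, 0 <= w j) ->
  (\esum_(j in setT) (`|kernel_op K phi j| * w j)%:E <=
   \esum_(i in setT) ((`|phi i|)%:E * \esum_(j in setT) (`|K i j| * w j)%:E))%E.
Proof.
move=> w0.
apply: (@le_trans _ _ (\esum_(j in setT) \esum_(i in setT)
    (w j * (`|phi i| * `|K i j|))%:E)%E).
  apply: le_esum => j _; under eq_esum do rewrite EFinM.
  rewrite esumZl// muleC EFinM lee_wpmul2r ?lee_fin//.
  apply: le_trans (le_norm_abs_sum _) _.
  by apply: le_esum => i _; rewrite normrM.
rewrite exchange_esum; last by move=> i j; rewrite lee_fin !mulr_ge0.
apply: le_esum => i _; rewrite -esumZl//.
  by apply: le_esum => j _; rewrite -EFinM lee_fin mulrC mulrA.
by move=> j; rewrite lee_fin mulr_ge0.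
Qed.

(** Associativity of the product of a row phi, a matrix K and a column L, under
absolute summability of the double series. *)
Lemma kernel_op_assoc (I J : choiceType) (K : I -> J -> R) (L : J -> R)
    (phi : I -> R) :
  (\esum_(i in setT) ((`|phi i|)%:E * l1norm (fun j => (K i j * L j)%R)) < +oo)%E ->
  abs_sum (fun j => kernel_op K phi j * L j) =
  abs_sum (fun i => phi i * abs_sum (fun j => K i j * L j)).
Proof.
move=> h; transitivity (abs_sum (fun j => abs_sum (fun i => L j * (phi i * K i j)))).
  by congr abs_sum; apply/funext => j; rewrite abs_sumZ mulrC.
rewrite exchange_abs_sum.
  congr abs_sum; apply/funext => i; rewrite -abs_sumZ.
  by congr abs_sum; apply/funext => j; rewrite mulrC mulrA.
apply: le_lt_trans h; rewrite /l1norm exchange_esum; last first.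
  by move=> i j; rewrite lee_fin.
apply: le_esum => i _; rewrite -esumZl//; apply: le_esum => j _.
by rewrite -EFinM -normrM mulrC mulrA.
Qed.

Lemma kernel_op_linear (I J : choiceType) (K : I -> J -> R) (a : R)
    (phi psi : I -> R) (j : J) :
  (l1norm (fun i => (phi i * K i j)%R) < +oo)%E ->
  (l1norm (fun i => (psi i * K i j)%R) < +oo)%E ->
  kernel_op K (fun i => a * phi i + psi i) j =
  a * kernel_op K phi j + kernel_op K psi j.
Proof.
move=> hphi hpsi; rewrite /kernel_op -abs_sumZ -abs_sumD//.
  by congr abs_sum; apply/funext => i; rewrite mulrDl mulrA.
rewrite /l1norm; under eq_esum do rewrite normrM EFinM.
by rewrite esumZl// lte_mul_pinfty// lee_fin.
Qed.

End AbsSum.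

(** * Boundary and prism operators on sequences *)

Section SeqChains.
Variables (R : comNzRingType) (T : eqType).
Implicit Types (F : seq T -> R) (s : seq T).

(** The functional F evaluated on the boundary of the tuple s. The recursion comes
from the formula d (a s') = s' - a (d s'), where a is prepended to every term
of d s'. *)
Fixpoint face_sum F s : R :=
  if s is a :: s' then F s' - face_sum (fun z => F (a :: z)) s' else 0.

(** The functional F evaluated on the prism between the images of s under f and
under g. *)
Fixpoint prism_sum (f g : T -> T) F s : R :=
  if s is a :: s' then
    F (f a :: g a :: map g s') - prism_sum f g (fun z => F (f a :: z)) s'
  else 0.

Lemma face_sumB F G s : face_sum (fun z => F z - G z) s = face_sum F s - face_sum G s.
Proof. by elim: s F G => [|a s IH] F G /=; rewrite ?subr0// IH; ring. Qed.

Lemma prism_sumB f g F G s :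
  prism_sum f g (fun z => F z - G z) s = prism_sum f g F s - prism_sum f g G s.
Proof. by elim: s F G => [|a s IH] F G /=; rewrite ?subr0// IH; ring. Qed.

Lemma face_sum_map (g : T -> T) F s : face_sum F (map g s) = face_sum (F \o map g) s.
Proof. by elim: s F => //= a s IH F; rewrite IH. Qed.

(** For a :: s in place of s, the prisms over s that do not start with f a cancel,
and so do the faces of the first simplex f a :: g a :: map g s that keep both
vertices f a and g a. The rest is the same identity for s and the functional
z |-> F (f a :: z), up to the two values of F that telescope. *)
Lemma prism_sum_homotopy f g F s :
  prism_sum f g (face_sum F) s + face_sum (prism_sum f g F) s = F (map g s) - F (map f s).
Proof.
elim: s F => [|a s IH] F /=; first by rewrite addr0 subrr.
rewrite prism_sumB face_sumB (face_sum_map g (fun z => F (f a :: g a :: z))) /=.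
by rewrite (canRL (addrK _) (IH (fun z => F (f a :: z)))); ring.
Qed.

Fixpoint stutters s : bool :=
  if s is a :: s' then (if s' is b :: _ then a == b else false) || stutters s'
  else false.

(** Functionals on sequences that descend to normalized chains. *)
Definition vanishing F := forall s, stutters s -> F s = 0.

Lemma vanishing_cons a F : vanishing F -> vanishing (fun z => F (a :: z)).
Proof. by move=> F0 s hs; apply: F0; rewrite /= hs orbT. Qed.

Lemma face_sum0 F s : (forall z, F z = 0) -> face_sum F s = 0.
Proof. by elim: s F => //= a s IH F F0; rewrite F0 IH ?subr0. Qed.

Lemma prism_sum0 f g F s : (forall z, F z = 0) -> prism_sum f g F s = 0.
Proof. by elim: s F => //= a s IH F F0; rewrite F0 IH ?subr0. Qed.

Lemma stutters_map (g : T -> T) s : stutters s -> stutters (map g s).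
Proof.
elim: s => //= a s IH /orP[|/IH ->]; rewrite ?orbT//.
by case: s {IH} => //= b s /eqP ->; rewrite eqxx.
Qed.

(** Degenerate chains form a subcomplex: two equal consecutive entries produce two
equal faces with opposite signs, and the other faces are degenerate. *)
Lemma vanishing_face_sum F : vanishing F -> vanishing (face_sum F).
Proof.
move=> F0 s; elim: s F F0 => //= a [|b s]// IH F F0 /orP[/eqP <-|hs].
  rewrite /= (face_sum0 _ (F := fun z => F [:: a, a & z])); first by ring.
  by move=> z; apply: F0; rewrite /= eqxx.
by rewrite F0// IH ?subr0//; exact: vanishing_cons.
Qed.

(** The prism of a degenerate sequence consists of degenerate sequences, hence the
prism operator is defined on normalized chains. *)
Lemma vanishing_prism_sum f g F : vanishing F -> vanishing (prism_sum f g F).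
Proof.
move=> F0 s; elim: s F F0 => // a [|b s]// IH F F0 hs.
rewrite -/(stutters [:: b & s]) in IH *.
have -> : prism_sum f g F [:: a, b & s] =
  F (f a :: g a :: map g (b :: s)) - prism_sum f g (fun z => F (f a :: z)) (b :: s) by [].
rewrite F0 ?sub0r; last by apply/orP; right; exact: (stutters_map g hs).
have /orP[/eqP ab|hs'] : (a == b) || stutters (b :: s) by [].
  rewrite -ab /= F0 ?(prism_sum0 _ _ (F := fun z => F _)) ?subr0 ?oppr0//=.
    by move=> z; apply: F0; rewrite /= eqxx.
  by rewrite eqxx.
by rewrite IH ?oppr0//; exact: vanishing_cons.
Qed.

(** If f and g agree on the entries of s, every simplex of the prism repeats an
entry. *)
Lemma prism_sum_eq_in f g F s : vanishing F -> {in s, f =1 g} -> prism_sum f g F s = 0.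
Proof.
elim: s F => //= a s IH F F0 fg; rewrite F0 /= ?fg ?mem_head ?eqxx//.
rewrite sub0r IH ?oppr0//; first exact: vanishing_cons.
by move=> x xs; rewrite fg// inE xs orbT.
Qed.

Lemma face_sumE F s :
  face_sum F s = \sum_(j < size s) (-1) ^+ j * F (take j s ++ drop j.+1 s).
Proof.
elim: s F => [|a s IH] F /=; first by rewrite big_ord0.
rewrite big_ord_recl expr0 mul1r /= drop0 IH -sumrN; congr (_ + _).
by apply: eq_bigr => j _; rewrite /bump /= add1n exprS mulN1r mulNr.
Qed.

Definition prism_seq (f g : T -> T) (j : nat) s : seq T :=
  map f (take j.+1 s) ++ map g (drop j s).

Lemma prism_sumE f g F s :
  prism_sum f g F s = \sum_(j < size s) (-1) ^+ j * F (prism_seq f g j s).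
Proof.
elim: s F => [|a s IH] F /=; first by rewrite big_ord0.
rewrite big_ord_recl expr0 mul1r /prism_seq /= take0 IH -sumrN; congr (_ + _).
by apply: eq_bigr => j _; rewrite /bump /= add1n exprS mulN1r mulNr.
Qed.

End SeqChains.

(** * Tuples and kernels with finite rows *)

Section FiniteKernels.
Variables (R : realType) (X : metricType R).

(** The coefficient of the simplex y in the normalized chain of the simplex s. *)
Definition coefficient (y s : seq X) : R := (~~ stutters y && (s == y))%:R.

Lemma vanishing_coefficient y : vanishing (coefficient y).
Proof.
by move=> s hs; rewrite /coefficient; case: eqP => [<-|]; rewrite ?hs ?andbF.
Qed.

Lemma stuttersP (x0 : X) s :
  reflect (exists2 i, (i.+1 < size s)%N & nth x0 s i == nth x0 s i.+1)
          (stutters s).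
Proof.
apply: (iffP idP).
  elim: s => //= a [|b s] //= IH /orP[ab|/IH[i hi e]]; first by exists 0%N.
  by exists i.+1.
case=> i; elim: s i => //= a s IH [|i] /=; first by case: s {IH} => //= b s _ ->.
by rewrite ltnS => /IH h /h ->; rewrite orbT.
Qed.

Lemma degenerateE n (x : n.+1.-tuple X) : degenerate x = stutters x.
Proof.
pose x0 := thead x.
apply/existsP/(stuttersP x0) => [[j]|[i]].
  rewrite !(tnth_nth x0) /= /bump /= add1n => e; exists (nat_of_ord j) => //.
  by rewrite size_tuple ltnS.
rewrite size_tuple ltnS => hi e; exists (Ordinal hi).
by rewrite !(tnth_nth x0) /= /bump /= add1n.
Qed.

Lemma tuple_chainE n (x y : n.+1.-tuple X) : tuple_chain x y = coefficient y x.
Proof.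
rewrite /tuple_chain /coefficient degenerateE -val_eqE /= eq_sym.
by case: eqP => [->|_]; rewrite ?andbF ?andbT; case: ifP.
Qed.

Lemma face_seq n (x : n.+2.-tuple X) (j : 'I_n.+2) :
  face j x = take j x ++ drop j.+1 x :> seq X.
Proof.
have sz : size (take j x ++ drop j.+1 x) = n.+1.
  by rewrite size_cat size_drop size_takel size_tuple 1?ltnW// addnBA//; lia.
apply: (@eq_from_nth _ (thead x)); rewrite size_tuple ?sz// => i hi.
rewrite -[i]/(nat_of_ord (Ordinal hi)) -tnth_nth tnth_mktuple (tnth_nth (thead x)) /=.
have sj : size (take j x) = j by rewrite size_takel// size_tuple ltnW.
rewrite nth_cat sj nth_drop /bump leqNgt.
case: ltnP => hij /=; first by rewrite add0n nth_take.
by rewrite add1n; congr nth; lia.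
Qed.

Lemma tuple_boundaryE n (x : n.+2.-tuple X) (y : n.+1.-tuple X) :
  tuple_boundary x y = face_sum (coefficient y) x.
Proof.
rewrite face_sumE size_tuple; apply: eq_bigr => j _.
by rewrite tuple_chainE face_seq.
Qed.

(** The restriction of the sum to nondegenerate simplices is what turns the number
of prisms into the number of jumps of the combing. *)
Lemma finite_kernel_norm n (I : Type) (r : seq I) (c : I -> R)
    (t : I -> n.+1.-tuple X) (w : n.+1.-tuple X -> R) :
  (forall i, `|c i| <= 1) -> (forall y, 0 <= w y) ->
  (\esum_(y in setT) (`|\sum_(i <- r) c i * tuple_chain (t i) y| * w y)%:E <=
   (\sum_(i <- r | ~~ degenerate (t i)) w (t i))%:E)%E.
Proof.
move=> c1 w0.
have -> : (\esum_(y in setT) (`|\sum_(i <- r) c i * tuple_chain (t i) y| * w y)%:E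
  = l1norm (fun y => (\sum_(i <- r) c i * tuple_chain (t i) y * w y)%R))%E.
  apply: eq_esum => y _; rewrite -big_distrl /= normrM (ger0_norm (w0 y))//.
apply: le_trans (le_l1norm_sum _ _) _.
rewrite -sumEFin [leRHS]big_mkcond; apply: lee_sum => i _.
rewrite /tuple_chain; case: (boolP (degenerate (t i))) => _ /=.
  by rewrite /l1norm esum1// => y _; rewrite mulr0 mul0r normr0.
have -> : l1norm (fun y => c i * (y == t i)%:R * w y) = (`|c i * w (t i)|)%:E.
  rewrite -(l1norm_delta (t i) (fun y => c i * w y)).
  by congr l1norm; apply/funext => y; rewrite mulrAC mulrC.
by rewrite lee_fin normrM (ger0_norm (w0 _)) ler_piMl.
Qed.

(** Summing a functional against the coefficients of a finite chain evaluates it on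
that chain; degenerate simplices have no coefficients, but there the functional
vanishes. *)
Lemma finite_kernel_pair n (I : Type) (r : seq I) (c : I -> R)
    (t : I -> n.+1.-tuple X) (F : seq X -> R) : vanishing F ->
  abs_sum (fun y => (\sum_(i <- r) c i * tuple_chain (t i) y) * F (val y)) =
  \sum_(i <- r) c i * F (t i).
Proof.
move=> F0; have E i y : c i * tuple_chain (t i) y * F (val y) =
    (y == t i)%:R * (c i * F (val y)).
  rewrite tuple_chainE /coefficient.
  have -> : (t i == y :> seq X) = (y == t i) by rewrite eq_sym -val_eqE.
  case: (y =P t i) => [->|_]; last by rewrite andbF mulr0 !mul0r.
  rewrite andbT mul1r.
  by case: (boolP (stutters (t i))) => [/F0 ->|_]; rewrite ?mulr0 ?mulr1.
transitivity (abs_sum (fun y => \sum_(i <- r) (y == t i)%:R * (c i * F (val y)))).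
  congr abs_sum; apply/funext => y; rewrite big_distrl.
  by apply: eq_bigr => i _; exact: E.
rewrite abs_sum_sum => [|i].
  by apply: eq_bigr => i _; rewrite (abs_sum_delta (t i) (fun y => c i * F (val y))).
by rewrite (l1norm_delta (t i) (fun y => c i * F (val y))) ltry.
Qed.

Lemma face_subset n (x : n.+2.-tuple X) (j : 'I_n.+2) : {subset face j x <= x}.
Proof.
move=> a; have -> : (a \in face j x) = (a \in take j x ++ drop j.+1 x).
  by rewrite -face_seq.
by rewrite mem_cat => /orP[]; [exact: mem_take|exact: mem_drop].
Qed.

End FiniteKernels.

(** * The kernel of the combing homotopy *)

Section Homotopy.
Variables (R : realType) (X : metricType R) (f : nat -> X -> X) (N0 : X -> nat).
Hypothesis f_stable : forall x m, (N0 x <= m)%N -> f m x = x.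

Definition settle (s : seq X) : nat := (\max_(a <- s) N0 a)%N.

Lemma settleP s m a : (settle s <= m)%N -> a \in s -> f m a = a.
Proof.
by move=> sm sa; apply: f_stable; apply: leq_trans sm; exact: leq_bigmax_seq.
Qed.

Lemma settle_sub s s' : {subset s <= s'} -> (settle s <= settle s')%N.
Proof.
move=> ss; apply/bigmax_leqP_seq => a sa _.
by apply: leq_bigmax_seq => //; exact: ss.
Qed.

(** The functional F evaluated on the sum over all i of the prisms from f i to
f i.+1; after the time settle s they are degenerate. *)
Definition combing_prism (F : seq X -> R) (s : seq X) : R :=
  \sum_(i < settle s) prism_sum (f i) (f i.+1) F s.

(** The number of prisms in the sum can be increased at will. This makes the sums
for a tuple and for its faces comparable, although their settling times differ. *)
Lemma combing_prism_widen F s M : vanishing F -> (settle s <= M)%N ->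
  combing_prism F s = \sum_(i < M) prism_sum (f i) (f i.+1) F s.
Proof.
move=> F0 sM; rewrite /combing_prism.
rewrite (big_ord_widen M (fun i => prism_sum (f i) (f i.+1) F s) sM).
rewrite big_mkcond /=.
apply: eq_bigr => i _; case: ltnP => // hi.
by rewrite (prism_sum_eq_in F0)// => a sa; rewrite !(settleP _ sa)// ltnW.
Qed.

Lemma vanishing_combing_prism F : vanishing F -> vanishing (combing_prism F).
Proof.
by move=> F0 s hs; rewrite /combing_prism big1// => i _; exact: vanishing_prism_sum.
Qed.

Definition prism_kernel n (x : n.+1.-tuple X) (y : n.+2.-tuple X) : R :=
  combing_prism (coefficient y) x.

Fact size_prism_seq (g h : X -> X) n (x : n.+1.-tuple X) (j : 'I_n.+1) :
  size (prism_seq g h j x) == n.+2.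
Proof.
by rewrite size_cat !size_map size_drop size_takel size_tuple//; have := ltn_ord j; lia.
Qed.

Definition prism_simplex (g h : X -> X) n (x : n.+1.-tuple X) (j : 'I_n.+1) :
  n.+2.-tuple X := Tuple (size_prism_seq g h x j).

(** The simplices of the sum of prisms over x, indexed by the time and by the
position of the doubled vertex. *)
Definition prism_at n (x : n.+1.-tuple X) (p : 'I_(settle x) * 'I_n.+1) :=
  prism_simplex (f p.1) (f p.1.+1) x p.2.

Lemma combing_prismE F n (x : n.+1.-tuple X) :
  combing_prism F x = \sum_(p : 'I_(settle x) * 'I_n.+1) (-1) ^+ p.2 * F (prism_at p).
Proof.
rewrite -(pair_bigA _ (fun i j => (-1) ^+ nat_of_ord j * F (@prism_at n x (i, j)))) /=.
by apply: eq_bigr => i _; rewrite prism_sumE size_tuple.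
Qed.

Lemma prism_kernelE n (x : n.+1.-tuple X) (y : n.+2.-tuple X) :
  prism_kernel x y =
    \sum_(p : 'I_(settle x) * 'I_n.+1) (-1) ^+ p.2 * tuple_chain (prism_at p) y.
Proof.
rewrite /prism_kernel combing_prismE.
by apply: eq_bigr => p _; rewrite tuple_chainE.
Qed.

Lemma prism_kernel_pair n (x : n.+1.-tuple X) (F : seq X -> R) : vanishing F ->
  abs_sum (fun y => prism_kernel x y * F (val y)) = combing_prism F x.
Proof.
move=> F0; under [X in abs_sum X]eq_fun do rewrite prism_kernelE.
by rewrite finite_kernel_pair// combing_prismE.
Qed.

Lemma boundary_pair n (x : n.+2.-tuple X) (F : seq X -> R) : vanishing F ->
  abs_sum (fun y => tuple_boundary x y * F (val y)) = face_sum F x.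
Proof.
move=> F0; rewrite finite_kernel_pair// face_sumE size_tuple.
by apply: eq_bigr => j _; rewrite face_seq.
Qed.

(** The prism identities for the consecutive maps of the combing telescope. *)
Lemma combing_prism_homotopy F (s : seq X) : vanishing F ->
  combing_prism (face_sum F) s + face_sum (combing_prism F) s = F s - F (map (f 0%N) s).
Proof.
move=> F0; rewrite face_sumE.
transitivity (\sum_(i < settle s) (F (map (f i.+1) s) - F (map (f i) s))).
  under [X in _ + X]eq_bigr => j _.
    rewrite (combing_prism_widen F0 (M := settle s)); last first.
      apply: settle_sub => a; rewrite mem_cat.
      by case/orP; [exact: mem_take|exact: mem_drop].
    rewrite big_distrr /=; over.
  rewrite exchange_big -big_split /=; apply: eq_bigr => i _.
  by rewrite -face_sumE prism_sum_homotopy.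
rewrite -(big_mkord predT (fun i => F (map (f i.+1) s) - F (map (f i) s))).
rewrite telescope_sumr//; congr (F _ - _).
by apply: map_id_in => a sa; rewrite (settleP (leqnn _) sa).
Qed.

End Homotopy.

(** * Controlled chains on a proper space *)

Section ProperSums.
Variables (R : realType) (X : metricType R).
Hypothesis hproper : proper_metric X.

Lemma finite_ball (x : X) (r : R) : finite_set [set y | mdist x y <= r].
Proof.
apply: hproper; exists (r + r) => y z /= xy xz.
by apply: le_trans (metric_triangle y x z) _; rewrite (metric_sym y) lerD.
Qed.

(** Together with the finiteness of balls, this makes all sums over the simplices
of bounded diameter through a given point finite. *)
Lemma finite_tuples n (A : set X) : finite_set A ->
  finite_set [set t : n.-tuple X | forall a, a \in t -> A a].
Proof.
move=> finA; pose B := fset_set A.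
apply: (@sub_finite_set _ _
  ((fun u : n.-tuple B => [tuple of map val u]) @` setT)); last first.
  exact/finite_image/finite_finset.
move=> t /= tA.
have tB i : tnth t i \in B by rewrite in_fset_set//; apply/mem_set/tA/mem_tnth.
exists [tuple [` tB i]%fset | i < n] => //.
by apply: eq_from_tnth => i; rewrite tnth_map tnth_mktuple.
Qed.

Definition weighted (w : X -> R) (phi : X -> R) : \bar R :=
  \esum_(x in setT) (`|phi x| * w x)%:E.

Definition wnorm (w : X -> R) n (phi : chain X n) : \bar R :=
  \esum_(x in setT) (`|phi x| * w (thead x))%:E.

Lemma controlled_near r n (phi : chain X n) (x : n.+1.-tuple X) a b :
  controlled r phi -> phi x != 0 -> a \in x -> b \in x -> mdist a b <= r%:R.
Proof.
move=> phir phix /tnthP[i ->] /tnthP[j ->]; rewrite leNgt.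
by apply: contra_neqN phix => h; apply: phir; exists i, j.
Qed.

Lemma marginal_esum r n (phi : chain X n) (x : X) : controlled r phi ->
  (marginal phi x)%:E =
    (\esum_(t in [set: n.-tuple X]) (`|phi [tuple of x :: t]|)%:E)%E.
Proof.
move=> phir; pose A := [set t : n.-tuple X | forall a, a \in t -> mdist x a <= r%:R].
have finA : finite_set A by apply: finite_tuples; exact: finite_ball.
have A0 (t : n.-tuple X) : ~ A t -> phi [tuple of x :: t] = 0.
  move=> nA; apply/eqP; apply: contra_notT nA => phit a ta.
  by apply: (controlled_near phir phit); rewrite inE ?eqxx// ta orbT.
transitivity (\esum_(t in A) (`|phi [tuple of x :: t]|)%:E)%E.
  rewrite esum_fset// fsumEFin//; congr (_%:E).
  apply/esym/fsbig_widen => // t [_ /A0 /= ->]; rewrite normr0//.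
rewrite esum_mkcond; apply: eq_esum => t _; case: ifPn => //.
by rewrite notin_setE => /A0 ->; rewrite normr0.
Qed.

Lemma marginal_ge0 n (phi : chain X n) x : 0 <= marginal phi x.
Proof. exact: fsumr_ge0. Qed.

(** The marginal sums over all vertices but the first. Hence the norms of chains can
be computed on tuples, where the homotopy is a matrix. *)
Lemma weighted_marginal w r n (phi : chain X n) :
  (forall x, 0 <= w x) -> controlled r phi ->
  weighted w (marginal phi) = wnorm w phi.
Proof.
move=> w0 phir.
transitivity (\esum_(x in setT) \esum_(t in [set: n.-tuple X])
   (`|phi [tuple of x :: t]| * w x)%:E)%E.
  apply: eq_esum => x _; rewrite ger0_norm ?marginal_ge0// mulrC EFinM.
  rewrite (marginal_esum _ phir) -esumZl//.
  by apply: eq_esum => t _; rewrite -EFinM mulrC.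
rewrite esum_esum; last by move=> x t _ _; rewrite lee_fin mulr_ge0.
rewrite /wnorm (reindex_esum ([set: X] `*`` fun=> [set: n.-tuple X]) _
  (fun p => [tuple of p.1 :: p.2]))//=.
split => //=.
- by move=> [x t] [y u] _ _ /= /(congr1 val) /= [-> /val_inj ->].
- by move=> t _; exists (thead t, [tuple of behead t]) => //=; rewrite -tuple_eta.
Qed.

(** A controlled simplex that has y as a face lies in a ball around the first
vertex of y, so only finitely many simplices contribute to the boundary at y. *)
Lemma boundary_kernel r n (phi : chain X n.+1) (y : n.+1.-tuple X) :
  controlled r phi ->
  boundary phi y = kernel_op (@tuple_boundary R X n) phi y.
Proof.
move=> phir; rewrite /boundary /kernel_op.
apply: (@abs_sum_finite _ _
  [set x : n.+2.-tuple X | forall a, a \in x -> mdist (thead y) a <= r%:R]).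
  by apply: finite_tuples; exact: finite_ball.
move=> x nA; apply/eqP; apply: contra_notT nA; rewrite mulf_eq0 negb_or.
move=> /andP[phix bx] a ax; apply: (controlled_near phir phix) => //.
have [/existsP[j /eqP fj]|] := boolP [exists j, face j x == y].
  by apply: (face_subset (j := j)); rewrite fj; apply: mem_tnth.
rewrite negb_exists => /forallP nf; case/eqP: bx.
apply: big1 => j _; rewrite /tuple_chain eq_sym (negPf (nf j)).
by case: ifP; rewrite mulr0.
Qed.

End ProperSums.

(** * The combing homotopy on tempered chains *)

Section CombingHomotopy.
Variables (R : realType) (X : metricType R).
Hypothesis hproper : proper_metric X.
Variables (f : nat -> X -> X) (N0 : X -> nat) (star : X) (C S : R).
Hypothesis f_stable : forall x m, (N0 x <= m)%N -> f m x = x.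
Hypothesis f_start : forall x, f 0%N x = star.
Hypothesis C_ge0 : 0 <= C.
Hypothesis f_lip : forall x y n, mdist (f n x) (f n y) <= C * (mdist x y + 1).
Hypothesis f_step : forall x n, mdist (f n x) (f n.+1 x) <= S.

Local Notation prism_kernel := (@prism_kernel R X f N0).

(** The sum over the times i at which the combing moves x' is the contribution of
one vertex x' to the w-norm of the homotopy applied to a tuple with first
vertex x. As v and w are at least 1, the chains of finite v-norm and
their images are absolutely summable. *)
Definition dominates (v w : X -> R) := [/\ forall x, 1 <= v x,
  forall x, 1 <= w x &
  forall r : R, exists2 c, 0 <= c & forall x x' M, mdist x x' <= r ->
    \sum_(i < M | f i x' != f i.+1 x') w (f i x) <= c * v x].

Definition homotopy n (phi : chain X n) : chain X n.+1 :=
  kernel_op (@prism_kernel n) phi.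

(** This is why a vertex contributes to the homotopy only at the times at which the
combing moves it. *)
Lemma degenerate_prism_simplex (g h : X -> X) n (x : n.+1.-tuple X) (j : 'I_n.+1) :
  g (tnth x j) = h (tnth x j) -> degenerate (prism_simplex g h x j).
Proof.
move=> e; rewrite degenerateE; apply/(stuttersP (thead x)); exists j => /=.
  by rewrite size_tuple; have := ltn_ord j; lia.
have sz : size (map g (take j.+1 x)) = j.+1 by rewrite size_map size_takel ?size_tuple.
rewrite /prism_seq !nth_cat !sz ltnS leqnn ltnn subnn.
rewrite (nth_map (thead x)) ?size_takel ?size_tuple//.
rewrite (nth_map (thead x)) ?size_drop ?size_tuple ?subn_gt0//.
by rewrite nth_take// nth_drop addn0 -!(tnth_nth (thead x)) e.
Qed.

Lemma thead_prism_simplex (g h : X -> X) n (x : n.+1.-tuple X) (j : 'I_n.+1) :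
  thead (prism_simplex g h x j) = g (thead x).
Proof.
rewrite /thead !(tnth_nth star) /=; case: (tupleP x) => a t /=.
by rewrite /prism_seq /=.
Qed.

Lemma prism_kernel_norm n (x : n.+1.-tuple X) (u : X -> R) : (forall a, 0 <= u a) ->
  (\esum_(y in setT) (`|prism_kernel x y| * u (thead y))%:E <=
   (\sum_(j < n.+1) \sum_(i < settle N0 x |
       f i (tnth x j) != f i.+1 (tnth x j)) u (f i (thead x)))%:E)%E.
Proof.
move=> u0; under eq_esum do rewrite prism_kernelE.
apply: le_trans (finite_kernel_norm _ _ _ _) _ => //.
  by move=> p; rewrite normrX normrN1 expr1n.
rewrite lee_fin; under [leRHS]eq_bigr do rewrite big_mkcond /=.
rewrite [leRHS]exchange_big pair_bigA big_mkcond /=; apply: ler_sum => p _.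
rewrite thead_prism_simplex; case: ifPn => [hp|_]; last by case: ifP.
by case: ifPn => //; rewrite negbK => /eqP e; rewrite degenerate_prism_simplex in hp.
Qed.

(** The entrywise bound with an arbitrary point a near x, rather than the first
vertex, is what the faces of a simplex require: deleting the first vertex
changes the base point of the weights. *)
Lemma prism_kernel_dominated v w r n : dominates v w -> exists2 c, 0 <= c &
  forall (x : n.+1.-tuple X) a, (forall b, b \in x -> mdist a b <= r) ->
  (forall y, `|prism_kernel x y| <= c * v a) /\
  (a = thead x ->
   \esum_(y in setT) (`|prism_kernel x y| * w (thead y))%:E <= (c * v a)%:E)%E.
Proof.
move=> [_ w1 dom]; have [c c0 hc] := dom r.
have w0 a : 0 <= w a by exact: le_trans (w1 a).
exists (n.+1%:R * c); first by rewrite mulr_ge0.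
move=> x a xa.
have bound : \sum_(j < n.+1) \sum_(i < settle N0 x |
    f i (tnth x j) != f i.+1 (tnth x j)) w (f i a) <= n.+1%:R * c * v a.
  apply: (@le_trans _ _ (\sum_(j < n.+1) c * v a)).
    by apply: ler_sum => j _; apply/hc/xa/mem_tnth.
  by rewrite sumr_const card_ord -mulrA mulr_natl.
split => [y|ax]; last first.
  rewrite ax in bound; rewrite ax; apply: le_trans (prism_kernel_norm x w0) _.
  by rewrite lee_fin.
(* one coefficient is at most the norm for the constant weight 1, and 1 <= w *)
rewrite -lee_fin.
apply: (@le_trans _ _
    (\esum_(z in setT) (`|prism_kernel x z| * (fun=> 1) (thead z))%:E)%E).
  apply: esum_ge; exists [set y]; first by split.
  by rewrite fsbig_set1 mulr1.
apply: le_trans (prism_kernel_norm x (fun=> ler01)) _; rewrite lee_fin.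
by apply: le_trans bound; apply: ler_sum => j _; apply: ler_sum.
Qed.

Lemma esum_dominated (v : X -> R) c n (phi : chain X n) (g : n.+1.-tuple X -> \bar R) :
  0 <= c -> (forall a, 0 <= v a) ->
  (forall x, phi x != 0 -> (g x <= (c * v (thead x))%:E)%E) ->
  (\esum_(x in setT) ((`|phi x|)%:E * g x) <= c%:E * wnorm v phi)%E.
Proof.
move=> c0 v0 gv; rewrite -esumZl//; last by move=> x; rewrite lee_fin mulr_ge0.
apply: le_esum => x _; have [->|phix] := eqVneq (phi x) 0.
  by rewrite normr0 mul0e mul0r mule0.
by rewrite EFinM muleCA lee_wpmul2l ?lee_fin// -EFinM gv.
Qed.

Lemma near_thead r n (phi : chain X n) (x : n.+1.-tuple X) :
  controlled r phi -> phi x != 0 -> forall b, b \in x -> mdist (thead x) b <= r%:R.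
Proof.
by move=> phir phix b bx; apply: (controlled_near phir phix) => //; exact: mem_tnth.
Qed.

Lemma dominates_ge0 v w : dominates v w ->
  (forall a, 0 <= v a) /\ (forall a, 0 <= w a).
Proof.
by case=> v1 w1 _; split => a; [apply: le_trans (v1 a)|apply: le_trans (w1 a)].
Qed.

(** The uniformity of the constant in phi makes the homotopy bounded on the chains
of a given control. *)
Lemma wnorm_homotopy v w r n : dominates v w -> exists2 c, 0 <= c &
  forall phi : chain X n, controlled r phi ->
  (wnorm w (homotopy phi) <= c%:E * wnorm v phi)%E.
Proof.
move=> dom; have [c c0 hc] := prism_kernel_dominated r%:R n dom.
have [v0 w0] := dominates_ge0 dom.
exists c => // phi phir; apply: le_trans (le_kernel_op _ _ _) _ => //.
apply: esum_dominated => // x phix.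
by have [_] := hc x (thead x) (near_thead phir phix); apply.
Qed.

Lemma l1norm_prism_kernel v w r n (phi : chain X n) (y : n.+2.-tuple X) :
  dominates v w -> controlled r phi -> (wnorm v phi < +oo)%E ->
  (l1norm (fun x => (phi x * prism_kernel x y)%R) < +oo)%E.
Proof.
move=> dom phir phiv; have [c c0 hc] := prism_kernel_dominated r%:R n dom.
have [v0 w0] := dominates_ge0 dom.
apply: (@le_lt_trans _ _ (c%:E * wnorm v phi)%E); last first.
  by rewrite lte_mul_pinfty// lee_fin.
apply: le_trans (@esum_dominated v c n phi (fun x => (`|prism_kernel x y|)%:E) _ _ _) => //.
  by apply: le_esum => x _; rewrite normrM.
move=> x phix; rewrite lee_fin.
by have [+ _] := hc x (thead x) (near_thead phir phix); apply.
Qed.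

Lemma homotopy_linear v w r r' n (a : R) (phi psi : chain X n) :
  dominates v w -> controlled r phi -> controlled r' psi ->
  (wnorm v phi < +oo)%E -> (wnorm v psi < +oo)%E ->
  homotopy (fun x => a * phi x + psi x) =
    (fun y => a * homotopy phi y + homotopy psi y).
Proof.
move=> dom phir psir phiv psiv; apply/funext => y.
apply: kernel_op_linear; [exact: l1norm_prism_kernel dom phir phiv|].
exact: l1norm_prism_kernel dom psir psiv.
Qed.

Lemma prism_kernel_neq0 n (x : n.+1.-tuple X) y : prism_kernel x y != 0 ->
  exists p : 'I_(settle N0 x) * 'I_n.+1, y = prism_at f p.
Proof.
rewrite prism_kernelE => h; apply: contra_notP (negP h) => np; apply/eqP.
apply: big1 => p _; rewrite /tuple_chain; case: ifP => _; rewrite ?mulr0//.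
by case: eqP => [e|_]; [case: np; exists p|rewrite mulr0].
Qed.

Lemma mem_prism_seq (g h : X -> X) j s a : a \in prism_seq g h j s ->
  exists2 b, b \in s & a = g b \/ a = h b.
Proof.
rewrite mem_cat => /orP[] /mapP[b bs ->]; exists b; auto.
  exact: mem_take bs.
exact: mem_drop bs.
Qed.

Lemma S_ge0 : 0 <= S.
Proof. exact: le_trans (mdist_ge0 _ _) (f_step star 0). Qed.

(** Every vertex of a prism over x is the image under f i or f i.+1 of a vertex of
x, so Lipschitz maps with bounded steps keep the diameters under control. *)
Lemma controlled_homotopy r n (phi : chain X n) : controlled r phi ->
  controlled (Num.bound (C * (r%:R + 1) + S)) (homotopy phi).
Proof.
move=> phir y [i [j hij]]; rewrite /homotopy /kernel_op.
rewrite -[RHS](@abs_sum0 R (n.+1.-tuple X)); congr abs_sum; apply/funext => x.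
apply/eqP; move: hij; apply: contraTT; rewrite mulf_eq0 negb_or -leNgt.
move=> /andP[phix /prism_kernel_neq0[p yE]].
subst y; have near (b c : X) (k : nat) : b \in x -> c \in x ->
    mdist (f k b) (f k c) <= C * (r%:R + 1).
  move=> bx cx; apply: le_trans (f_lip _ _ _) _.
  by rewrite ler_wpM2l// lerD2r (controlled_near phir phix).
have near1 (b c : X) (k : nat) : b \in x -> c \in x ->
    mdist (f k b) (f k.+1 c) <= C * (r%:R + 1) + S.
  by move=> bx cx; apply: le_trans (metric_triangle _ (f k c) _) _; rewrite lerD ?near.
have {near} near b c k : b \in x -> c \in x ->
    mdist (f k b) (f k c) <= C * (r%:R + 1) + S.
  by move=> bx cx; rewrite (le_trans (near _ _ _ bx cx))// lerDl S_ge0.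
apply: (@le_trans _ _ (C * (r%:R + 1) + S)); last first.
  by apply/ltW/archi_boundP; rewrite addr_ge0 ?mulr_ge0 ?addr_ge0 ?S_ge0.
have mem k : exists2 b, b \in x &
    tnth (prism_at f p) k = f p.1 b \/ tnth (prism_at f p) k = f p.1.+1 b.
  exact: (mem_prism_seq (mem_tnth k (prism_at f p))).
have [a ax [->|->]] := mem i; have [b bx [->|->]] := mem j.
- exact: near.
- exact: near1.
- by rewrite metric_sym near1.
- exact: near.
Qed.

Lemma normalized_homotopy n (phi : chain X n) : normalized (homotopy phi).
Proof.
move=> y hy; rewrite -[RHS](@abs_sum0 R (n.+1.-tuple X)).
congr abs_sum; apply/funext => x.
rewrite [prism_kernel x y]big1 ?mulr0// => i _; apply: prism_sum0 => z.
by rewrite /coefficient -degenerateE hy.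
Qed.

Lemma l1norm_assoc (I J : choiceType) (K : I -> J -> R) (L : J -> R)
    (phi : I -> R) :
  (\esum_(i in setT) ((`|phi i|)%:E * l1norm (fun j => (K i j * L j)%R)) < +oo)%E ->
  (l1norm (fun i => (phi i * abs_sum (fun j => (K i j * L j)%R))%R) < +oo)%E.
Proof.
apply: le_lt_trans; apply: le_esum => i _.
by rewrite normrM EFinM lee_wpmul2l ?lee_fin// le_norm_abs_sum.
Qed.

Lemma norm_tuple_boundary n (x : n.+2.-tuple X) (y : n.+1.-tuple X) :
  `|tuple_boundary x y| <= n.+2%:R.
Proof.
apply: le_trans (ler_norm_sum _ _ _) _.
apply: (@le_trans _ _ (\sum_(j < n.+2) 1)); last by rewrite sumr_const card_ord.
apply: ler_sum => j _; rewrite normrM normrX normrN1 expr1n mul1r /tuple_chain.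
by case: ifP => _; [rewrite normr0|case: eqP; rewrite ?normr1 ?normr0].
Qed.

(** The boundary of the homotopy is the transpose of the boundary functional
applied to the sum of prisms: the double sum over the simplices of phi and of
their prisms converges absolutely, because the boundary has uniformly bounded
coefficients. *)
Lemma boundary_homotopy v w r n (phi : chain X n) (y : n.+1.-tuple X) :
  dominates v w -> controlled r phi -> (wnorm v phi < +oo)%E ->
  boundary (homotopy phi) y =
    abs_sum (fun x : n.+1.-tuple X =>
      phi x * combing_prism f N0 (face_sum (coefficient y)) x) /\
  (l1norm (fun x : n.+1.-tuple X =>
    (phi x * combing_prism f N0 (face_sum (coefficient y)) x)%R) < +oo)%E.
Proof.
move=> dom phir phiv; have [c c0 hc] := prism_kernel_dominated r%:R n dom.
have [v0 w0] := dominates_ge0 dom; have [v1 w1 _] := dom.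
pose L (z : n.+2.-tuple X) : R := face_sum (coefficient y) z.
have fin : (\esum_(x in setT)
    ((`|phi x|)%:E * l1norm (fun z => (prism_kernel x z * L z)%R)) < +oo)%E.
  apply: le_lt_trans (@esum_dominated v (n.+2%:R * c) n phi _ _ _ _) _ => //.
  - by rewrite mulr_ge0.
  - move=> x phix; have [_ /(_ erefl)] := hc x (thead x) (near_thead phir phix).
    move=> h; rewrite -mulrA EFinM.
    apply: le_trans (lee_wpmul2l _ h); last by rewrite lee_fin.
    rewrite -esumZl//; last by move=> z; rewrite lee_fin mulr_ge0.
    apply: le_esum => z _; rewrite -EFinM lee_fin normrM mulrC.
    apply: ler_pM => //; last by rewrite ler_peMr.
    by rewrite /L -tuple_boundaryE norm_tuple_boundary.
  - by rewrite lte_mul_pinfty// lee_fin mulr_ge0.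
have pairE x : abs_sum (fun z => prism_kernel x z * L z) =
    combing_prism f N0 (face_sum (coefficient y)) x.
  by apply: prism_kernel_pair; apply/vanishing_face_sum/vanishing_coefficient.
split; last first.
  have := l1norm_assoc fin; congr (_ < _)%E; congr l1norm.
  by apply/funext => x; rewrite pairE.
rewrite (boundary_kernel hproper _ (controlled_homotopy phir)).
transitivity (abs_sum (fun z => kernel_op (@prism_kernel n) phi z * L z)).
  by congr abs_sum; apply/funext => z; rewrite /L -tuple_boundaryE.
rewrite kernel_op_assoc//; congr abs_sum; apply/funext => x.
by rewrite pairE.
Qed.

(** Composition in the other order. The double series is dominated because all
faces of a simplex stay close to its first vertex. *)
Lemma homotopy_boundary v w r n (phi : chain X n.+1) (y : n.+2.-tuple X) :
  dominates v w -> controlled r phi -> (wnorm v phi < +oo)%E ->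
  homotopy (boundary phi) y =
    abs_sum (fun x : n.+2.-tuple X =>
      phi x * face_sum (combing_prism f N0 (coefficient y)) x) /\
  (l1norm (fun x : n.+2.-tuple X =>
    (phi x * face_sum (combing_prism f N0 (coefficient y)) x)%R) < +oo)%E.
Proof.
move=> dom phir phiv; have [c c0 hc] := prism_kernel_dominated r%:R n dom.
have [v0 w0] := dominates_ge0 dom; have [v1 w1 _] := dom.
pose L (z : n.+1.-tuple X) : R := prism_kernel z y.
pose K := @tuple_boundary R X n.
have fin : (\esum_(x in setT)
    ((`|phi x|)%:E * l1norm (fun z => (K x z * L z)%R)) < +oo)%E.
  apply: le_lt_trans (@esum_dominated v (n.+2%:R * c) n.+1 phi _ _ _ _) _ => //.
  - by rewrite mulr_ge0.
  - move=> x phix.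
    have -> : l1norm (fun z => K x z * L z) =
        (\esum_(z in setT) (`|K x z| * `|L z|)%:E)%E.
      by apply: eq_esum => z _; rewrite normrM.
    apply: le_trans (finite_kernel_norm _ _ _ _) _ => //.
      by move=> j; rewrite normrX normrN1 expr1n.
    rewrite lee_fin big_mkcond.
    apply: (@le_trans _ _ (\sum_(j < n.+2) c * v (thead x))); last first.
      by rewrite sumr_const card_ord -mulrA mulr_natl.
    apply: ler_sum => j _; case: ifP => _; last by rewrite mulr_ge0.
    have near b : b \in face j x -> mdist (thead x) b <= r%:R.
      by move/face_subset; exact: (near_thead phir phix).
    by have [+ _] := hc _ _ near; apply.
  - by rewrite lte_mul_pinfty// lee_fin mulr_ge0.
have pairE x : abs_sum (fun z => K x z * L z) = face_sum (combing_prism f N0 (coefficient y)) x.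
  by apply: boundary_pair; apply/vanishing_combing_prism/vanishing_coefficient.
split; last first.
  have := l1norm_assoc fin; congr (_ < _)%E; congr l1norm.
  by apply/funext => x; rewrite pairE.
transitivity (abs_sum (fun z => kernel_op K phi z * L z)).
  congr abs_sum; apply/funext => z.
  by rewrite (boundary_kernel hproper _ phir).
rewrite kernel_op_assoc//; congr abs_sum; apply/funext => x.
by rewrite pairE.
Qed.

Lemma normalized_coefficient n (phi : chain X n) (x y : n.+1.-tuple X) :
  normalized phi -> phi x * coefficient y x = (x == y)%:R * phi x.
Proof.
move=> phi0; rewrite /coefficient -degenerateE.
have -> : (x == y :> seq X) = (x == y) by rewrite -val_eqE.
case: (x =P y) => [->|_]; last by rewrite andbF mulr0 mul0r.
by rewrite andbT; case: (boolP (degenerate y)) => [/phi0 ->|_];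
  rewrite ?mulr0 ?mulr1 ?mul1r.
Qed.

(** In positive degree the constant map f 0 makes all tuples degenerate. *)
Lemma homotopy_identity v w r n (phi : chain X n.+1) :
  dominates v w -> controlled r phi -> normalized phi -> (wnorm v phi < +oo)%E ->
  boundary (homotopy phi) \+ homotopy (boundary phi) = phi.
Proof.
move=> dom phir phi0 phiv; apply/funext => y /=.
have [-> l1] := boundary_homotopy y dom phir phiv.
have [-> l2] := homotopy_boundary y dom phir phiv.
rewrite -abs_sumD// -[RHS](abs_sum_delta y phi); congr abs_sum; apply/funext => x.
rewrite -mulrDr (combing_prism_homotopy f_stable _ (vanishing_coefficient y)).
rewrite [coefficient y (map _ _)]vanishing_coefficient ?subr0 ?normalized_coefficient//.
by case: (tupleP x) => a t; case: (tupleP t) => b u /=; rewrite !f_start eqxx.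
Qed.

Lemma augmentationE (phi : chain X 0) : augmentation phi = abs_sum phi.
Proof.
have E (g : 1.-tuple X -> \bar R) :
    (\esum_(x in setT) g x = \esum_(a in setT) g [tuple a])%E.
  apply: reindex_esum; split => //= [a b _ _ /(congr1 val)[]//|x _].
  by case: (tupleP x) => a t; exists a => //; apply: val_inj; rewrite (tuple0 t).
by rewrite /augmentation /abs_sum !E.
Qed.

(** In degree 0 the constant map f 0 sends phi to its augmentation, placed at the
base point. *)
Lemma homotopy_identity0 v w r (phi : chain X 0) :
  dominates v w -> controlled r phi -> normalized phi -> (wnorm v phi < +oo)%E ->
  augmentation phi = 0 -> boundary (homotopy phi) = phi.
Proof.
move=> dom phir phi0 phiv aug; apply/funext => y /=.
have [-> l1] := boundary_homotopy y dom phir phiv.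
have phil1 : (l1norm phi < +oo)%E.
  have [v1 _ _] := dom; apply: le_lt_trans phiv; apply: le_esum => x _.
  by rewrite lee_fin ler_peMr.
have E (x : 1.-tuple X) : combing_prism f N0 (face_sum (coefficient y)) x =
    coefficient y x - coefficient y [:: star].
  have := combing_prism_homotopy f_stable x (vanishing_coefficient y).
  case: (tupleP x) => a t; rewrite (tuple0 t) /= f_start => <-.
  by rewrite [combing_prism _ _ (coefficient y) _]big1 ?subr0 ?addr0.
transitivity (abs_sum (fun x =>
    (x == y)%:R * phi x + - coefficient y [:: star] * phi x)).
  congr abs_sum; apply/funext => x.
  by rewrite E mulrBr normalized_coefficient// mulNr [X in _ - X]mulrC.
rewrite abs_sumD.
- by rewrite abs_sum_delta abs_sumZ -augmentationE aug mulr0 addr0.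
- by rewrite l1norm_delta ltry.
- rewrite /l1norm; under eq_esum do rewrite normrM EFinM.
  by rewrite esumZl// lte_mul_pinfty// lee_fin.
Qed.

(** The estimate that the homotopy satisfies from a set P of marginals to the set
Q of marginals of the images. The constant depends on the pair of weights but
not on the element of Q, as boundedness of Q requires. *)
Definition uniformly_dominated (P Q : set (X -> R)) := forall v w, dominates v w ->
  exists2 c, 0 <= c & forall psi, Q psi -> exists2 phi, P phi &
    (weighted w psi <= c%:E * weighted v phi)%E.

(** The function spaces A and B enter only through the weights: the homotopy is
defined and linear on A if any two elements of A have finite norm for a common
dominating weight, and it maps A to B boundedly if dominated estimates transfer
membership and boundedness from A to B. *)
Lemma homotopy_null_homotopic (A B : bornSpace R X) :
  (forall phi psi, carrier A phi -> carrier A psi -> exists v w,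
    [/\ dominates v w, (weighted v phi < +oo)%E & (weighted v psi < +oo)%E]) ->
  (forall phi psi, carrier A phi ->
    uniformly_dominated [set phi] [set psi] -> carrier B psi) ->
  (forall P Q, bounded A P -> uniformly_dominated P Q -> bounded B Q) ->
  null_homotopic (redTC A) (redTC B) embedding.
Proof.
move=> hfin hcar hbnd.
have carE n phi : carrier (redTC A n) phi -> exists r,
    [/\ controlled r phi, normalized phi & carrier A (marginal phi)].
  by case: n phi => [|n] phi; [case|].
have bndE n P : bounded (redTC A n) P -> exists r,
    (forall phi, P phi -> controlled r phi) /\ bounded A (@marginal R X n @` P).
  case: n P => [|n] P.
    by case=> _ [r [sub bnd]]; exists r; split => // phi /sub[].
  by case=> r [sub bnd]; exists r; split => // phi /sub[].
have bndS n P : bounded (redTC A n) P -> P `<=` carrier (redTC A n).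
  case: n P => [|n] P; first by case=> sub _ phi /sub.
  by case=> r [sub _] phi /sub; exists r.
have dominatedE n r (P : set (chain X n)) : (forall phi, P phi -> controlled r phi) ->
    uniformly_dominated (@marginal R X n @` P)
      (@marginal R X n.+1 @` (@homotopy n @` P)).
  move=> Pr v w dom; have [v0 w0] := dominates_ge0 dom.
  have [c c0 hc] := wnorm_homotopy r n dom; exists c => // _ [_ [phi Pphi <-] <-].
  exists (marginal phi); first by exists phi.
  rewrite (weighted_marginal hproper w0 (controlled_homotopy (Pr _ Pphi))).
  by rewrite (weighted_marginal hproper v0 (Pr _ Pphi)); exact/hc/Pr.
have homotopyC n r phi : carrier (redTC A n) phi -> controlled r phi ->
    carrier (TC_at B n.+1 (Num.bound (C * (r%:R + 1) + S))) (homotopy phi).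
  move=> /carE[_ [_ phi0 Aphi]] phir; split.
  - exact: controlled_homotopy.
  - exact: normalized_homotopy.
  - apply: hcar Aphi _; have := @dominatedE n r [set phi]; rewrite !image_set1; apply.
    by move=> _ ->.
have finE n phi : carrier (redTC A n) phi -> exists r v w,
    [/\ dominates v w, controlled r phi, normalized phi & (wnorm v phi < +oo)%E].
  move=> /carE[r [phir phi0 Aphi]]; have [v [w [dom phiv _]]] := hfin _ _ Aphi Aphi.
  exists r, v, w; split => //.
  by rewrite -(weighted_marginal hproper (dominates_ge0 dom).1 phir).
exists homotopy; split.
- move=> n; split.
  + move=> phi Aphi; have [r [phir _ _]] := carE _ _ Aphi.
    by eexists; exact: homotopyC phir.
  + move=> a phi psi /carE[r [phir phi0 Aphi]] /carE[r' [psir psi0 Apsi]].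
    have [v [w [dom phiv psiv]]] := hfin _ _ Aphi Apsi.
    have v0 := (dominates_ge0 dom).1.
    rewrite (weighted_marginal hproper v0 phir) in phiv.
    rewrite (weighted_marginal hproper v0 psir) in psiv.
    exact: homotopy_linear dom phir psir phiv psiv.
  + move=> P bP; have [r [Pr bA]] := bndE _ _ bP.
    exists (Num.bound (C * (r%:R + 1) + S)); split.
      by move=> _ [phi Pphi <-]; apply: homotopyC; [exact: bndS bP _ Pphi|exact: Pr].
    exact: hbnd bA (dominatedE _ _ _ Pr).
- move=> phi Aphi; have [r [v [w [dom phir phi0 phiv]]]] := finE _ _ Aphi.
  apply: homotopy_identity0 dom phir phi0 phiv _.
  by case: Aphi.
- move=> n phi Aphi; have [r [v [w [dom phir phi0 phiv]]]] := finE _ _ Aphi.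
  exact: homotopy_identity dom phir phi0 phiv.
Qed.

End CombingHomotopy.

(** * Growth of combings and dominating weights *)

Section Growth.
Variables (R : realType) (X : metricType R) (star : X) (f : nat -> X -> X).
Hypothesis hcomb : combing star f.

Local Notation l := (len star).

Lemma powR_ge1 (t s : R) : 1 <= t -> 0 <= s -> 1 <= t `^ s.
Proof. by move=> t1 s0; rewrite -(powRr0 t) ler_powR. Qed.

Lemma len_ge0 x : 0 <= l x.
Proof. exact: mdist_ge0. Qed.

Lemma len_near x y r : mdist x y <= r -> l y <= l x + r.
Proof.
move=> xy; rewrite addrC; apply: le_trans (metric_triangle y x star) _.
by rewrite lerD2r metric_sym.
Qed.

Lemma combing_stable : exists N0 : X -> nat, forall x m, (N0 x <= m)%N -> f m x = x.
Proof.
have [_ st _ _] := hcomb; have [N0 hN] := choice st.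
by exists N0.
Qed.

(** The Lipschitz condition compares f n x with f n star instead of the base point
itself; but f n star takes only finitely many values, as the base point is
eventually fixed. *)
Lemma combing_len : exists2 D, 0 <= D & forall n x, l (f n x) <= D * (l x + 1).
Proof.
have [N0 hN] := combing_stable; have [_ _ [C C0 lip] _] := hcomb.
(* a crude bound for the lengths of the points that the base point visits *)
pose E := \sum_(i < N0 star) l (f i star).
have E0 : 0 <= E by apply: sumr_ge0 => i _; exact: len_ge0.
have fE n : l (f n star) <= E.
  have [hn|hn] := leqP (N0 star) n; first by rewrite hN// /len mdistxx.
  rewrite /E (bigD1 (Ordinal hn))//= lerDl; apply: sumr_ge0 => i _; exact: len_ge0.
exists (C + E) => [|n x]; first by rewrite addr_ge0// ltW.
apply: le_trans (metric_triangle _ (f n star) _) _.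
rewrite mulrDl; apply: lerD; first exact: lip.
by apply: le_trans (fE n) _; rewrite ler_peMr// lerDr len_ge0.
Qed.

Lemma sum_jumps (x : X) (M : nat) (u : nat -> R) (W : R) : 0 <= W ->
  (forall i, u i <= W) ->
  \sum_(i < M | f i x != f i.+1 x) u i <= (jumps f x)%:R * W.
Proof.
move=> W0 uW; have [N0 hN] := combing_stable.
have fin : finite_set [set n | f n x <> f n.+1 x].
  apply: (@sub_finite_set _ _ `I_(N0 x)); last exact: finite_II.
  by move=> n /= ne; rewrite ltnNge; apply/negP => h; apply: ne; rewrite !hN// ltnW.
apply: (@le_trans _ _ (\sum_(i < M | f i x != f i.+1 x) W)).
  by apply: ler_sum => i _.
rewrite -(big_mkord (fun i => f i x != f i.+1 x) (fun=> W)) -big_filter.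
rewrite big_const_seq iter_addr addr0 count_predT.
rewrite -[W *+ _]mulr_natl ler_wpM2r// ler_nat.
apply: uniq_leq_size; first by rewrite filter_uniq// iota_uniq.
move=> i; rewrite mem_filter => /andP[/eqP hi _].
by rewrite in_fset_set//; apply: mem_set.
Qed.

(** The sum over the jumps of x' is at most their number times a bound W x for the
weight w along the combing path of x. *)
Lemma dominates_jumps (v w W J : X -> R) :
  (forall x, 1 <= v x) -> (forall x, 1 <= w x) ->
  (forall n x, w (f n x) <= W x) -> (forall x, (jumps f x)%:R <= J x) ->
  (forall r, 0 <= r -> exists2 c, 0 <= c &
     forall x x', mdist x x' <= r -> J x' * W x <= c * v x) ->
  dominates f v w.
Proof.
move=> v1 w1 wW jJ H; split => // r.
have [c c0 hc] := H (Num.max r 0) (pos_part_ge0 r); exists c => // x x' M xx'.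
have W0 : 0 <= W x by apply: le_trans (wW 0%N x); apply: le_trans (w1 _).
apply: le_trans (sum_jumps x' M W0 (fun i => wW i x)) _.
apply: le_trans (ler_wpM2r W0 (jJ x')) _; apply: hc.
by rewrite le_max xx'.
Qed.

(** Lengths grow by a bounded factor along the combing, which costs a constant in
the weight (l + 1)^k, and the number of jumps costs the exponent m. *)
Lemma dominates_pol m k : poly_growth star m f -> 0 <= k ->
  dominates f (fun x => (l x + 1) `^ (k + m%:R)) (fun x => (l x + 1) `^ k).
Proof.
move=> [C0 hJ] k0; have [D D0 hD] := combing_len.
have l1 x : 1 <= l x + 1 by rewrite lerDr len_ge0.
have l0 x : 0 <= l x + 1 by exact: le_trans (l1 x).
pose C := Num.max C0 0; have C_ge0 : 0 <= C := pos_part_ge0 C0.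
have m0 : 0 <= k + m%:R by rewrite addr_ge0.
(* l (f n x) + 1 <= D (l x + 1) + 1 <= (D + 1) (l x + 1) *)
apply: (@dominates_jumps _ _ (fun x => (D + 1) `^ k * (l x + 1) `^ k)
  (fun x => C * (l x + 1) `^ m%:R)) => [x|x|n x|x|r r0].
- exact: powR_ge1.
- exact: powR_ge1.
- rewrite -powRM ?addr_ge0 ?len_ge0//; apply: ge0_ler_powR => //.
  + by rewrite nnegrE.
  + by rewrite nnegrE mulr_ge0// addr_ge0.
  + by rewrite mulrDl mul1r lerD.
- rewrite powR_mulrn//; apply: le_trans (hJ x) _.
  by rewrite ler_wpM2r ?exprn_ge0// le_max lexx.
- exists (C * (r + 1) `^ m%:R * (D + 1) `^ k).
    by rewrite !mulr_ge0 ?powR_ge0.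
  move=> x x' xx'.
  have -> : C * (r + 1) `^ m%:R * (D + 1) `^ k * (l x + 1) `^ (k + m%:R) =
     C * ((r + 1) * (l x + 1)) `^ m%:R * ((D + 1) `^ k * (l x + 1) `^ k).
    rewrite powRM ?addr_ge0 ?len_ge0// powRD; first by ring.
    by apply/implyP => _; rewrite gt_eqF// (lt_le_trans ltr01).
  rewrite ler_wpM2r ?mulr_ge0 ?powR_ge0// ler_wpM2l//.
  apply: ge0_ler_powR; rewrite ?nnegrE//.
    by rewrite mulr_ge0// addr_ge0.
  have := len_near xx'; have := mulr_ge0 r0 (len_ge0 x); lra.
Qed.

(** Lengths may grow by the factor D along the combing, which replaces the base b of
the weight by b^D, and the number of jumps costs the factor a. *)
Lemma dominates_exp : exists2 D, 0 <= D & forall C a b : R,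
  0 <= C -> 1 < a -> 1 < b -> (forall x, (jumps f x)%:R <= C * a `^ l x) ->
  dominates f (fun x => (b `^ D * a) `^ l x) (fun x => b `^ l x).
Proof.
have [D D0 hD] := combing_len; exists D => // C a b C0 a1 b1 hJ.
have a0 : 0 < a by exact: lt_trans a1.
have b0 : 0 < b by exact: lt_trans b1.
apply: (@dominates_jumps _ _ (fun x => b `^ (D * (l x + 1)))
  (fun x => C * a `^ l x)) => [x|x|n x|x|r r0].
- apply: powR_ge1; last exact: len_ge0.
  by rewrite -[leLHS]mulr1 ler_pM// ?powR_ge1// ltW.
- by apply: powR_ge1; [exact: ltW|exact: len_ge0].
- by rewrite ler_powR// ltW.
- exact: hJ.
- exists (C * a `^ r * b `^ D).
    by rewrite !mulr_ge0 ?powR_ge0.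
  move=> x x' xx'.
  have -> : C * a `^ r * b `^ D * (b `^ D * a) `^ l x =
     C * a `^ (l x + r) * b `^ (D * (l x + 1)).
    rewrite powRM ?powR_ge0 ?(ltW a0)// -powRrM mulrDr mulr1.
    rewrite !powRD ?(gt_eqF a0) ?(gt_eqF b0) ?implybT//; ring.
  by rewrite ler_wpM2r ?powR_ge0// ler_wpM2l// ler_powR ?len_near// ltW.
Qed.

End Growth.

(** * The four families of function spaces *)

Section Instances.
Variables (R : realType) (X : metricType R) (star : X).
Hypothesis hproper : proper_metric X.
Variable f : nat -> X -> X.
Hypothesis hcomb : combing star f.

Lemma combing_null_homotopic (A B : bornSpace R X) :
  (forall phi psi, carrier A phi -> carrier A psi -> exists v w,
    [/\ dominates f v w, (weighted v phi < +oo)%E & (weighted v psi < +oo)%E]) ->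
  (forall phi psi, carrier A phi ->
    uniformly_dominated f [set phi] [set psi] -> carrier B psi) ->
  (forall P Q, bounded A P -> uniformly_dominated f P Q -> bounded B Q) ->
  null_homotopic (redTC A) (redTC B) embedding.
Proof.
have [N0 hN] := combing_stable hcomb.
have [f0 _ [C /ltW C0 lip] [S hS]] := hcomb.
exact: (homotopy_null_homotopic hproper hN f0 C0 lip hS).
Qed.

Lemma uniformly_dominated1 (phi psi v w : X -> R) :
  uniformly_dominated f [set phi] [set psi] ->
  dominates f v w -> (weighted v phi < +oo)%E -> (weighted w psi < +oo)%E.
Proof.
move=> h /h[c c0 /(_ psi erefl)[_ -> le]] fin; apply: le_lt_trans le _.
by rewrite lte_mul_pinfty// lee_fin.
Qed.

Lemma uniformly_dominated_bounded (P Q : set (X -> R)) v w :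
  uniformly_dominated f P Q -> dominates f v w ->
  (exists M : R, forall phi, P phi -> (weighted v phi <= M%:E)%E) ->
  exists M : R, forall psi, Q psi -> (weighted w psi <= M%:E)%E.
Proof.
move=> h /h[c c0 hc] [M hM]; exists (c * M) => psi /hc[phi /hM le1 le2].
by apply: le_trans le2 _; rewrite EFinM lee_wpmul2l.
Qed.

Lemma le_weighted (v w phi : X -> R) : (forall x, v x <= w x) ->
  (weighted v phi <= weighted w phi)%E.
Proof. by move=> vw; apply: le_esum => x _; rewrite lee_fin ler_wpM2l. Qed.

Lemma null_homotopic_Spol m k : poly_growth star m f -> 0 <= k ->
  null_homotopic (redTC (Spol star (k + m%:R))) (redTC (Spol star k)) embedding.
Proof.
move=> hm k0; have dom := dominates_pol hcomb hm k0.
apply: combing_null_homotopic => [phi psi hphi hpsi|phi psi hphi h|P Q hP h].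
- by eexists; eexists; split; [exact: dom| |].
- exact: uniformly_dominated1 h dom hphi.
- exact: uniformly_dominated_bounded h dom hP.
Qed.

Lemma contractible_Sinfty m : poly_growth star m f ->
  contractible (redTC (Sinfty star)).
Proof.
move=> hm; have dom k := dominates_pol hcomb hm (ler0n R k).
have fin phi k : carrier (Sinfty star) phi ->
    (weighted (fun x => ((len star x + 1) `^ (k%:R + m%:R))%R) phi < +oo)%E.
  by move=> /(_ (k + m)%N); rewrite natrD.
apply: combing_null_homotopic => [phi psi hphi hpsi|phi psi hphi h k|P Q hP h k].
- by eexists; eexists; split; [exact: (dom 0%N)|exact: fin|exact: fin].
- exact: uniformly_dominated1 h (dom k) (fin _ _ hphi).
- apply: uniformly_dominated_bounded h (dom k) _.
  by have := hP (k + m)%N; rewrite natrD.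
Qed.

(** The base a of a given norm is split as b^(D + 1): the factor b^D absorbs the
distortion of lengths and the last factor b the number of jumps. *)
Lemma contractible_Somega : subexp_growth star f ->
  contractible (redTC (Somega star)).
Proof.
move=> hf; have [D D0 hD] := dominates_exp hcomb.
have D1 : 0 < D + 1 by rewrite ltr_wpDl.
have dom a : 1 < a -> exists2 b, 1 < b &
    dominates f (fun x => a `^ len star x) (fun x => b `^ len star x).
  move=> a1; have a0 : 0 <= a by rewrite ltW// (lt_trans _ a1).
  have b1 : 1 < a `^ (D + 1)^-1.
    have : 0 < (D + 1)^-1 by rewrite invr_gt0.
    by move=> /gt0_ltr_powR/(_ 1 a); rewrite powR1; apply; rewrite ?nnegrE.
  exists (a `^ (D + 1)^-1) => //.
  have [C C0 hC] := hf _ b1; have := hD C _ _ (ltW C0) b1 b1 hC.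
  have -> // : (a `^ (D + 1)^-1) `^ D * a `^ (D + 1)^-1 = a.
  rewrite -[X in _ * X]powRr1 ?powR_ge0// -powRD; last first.
    by apply/implyP => _; rewrite gt_eqF// (lt_trans _ b1).
  by rewrite -powRrM mulVf ?powRr1 ?gt_eqF.
apply: combing_null_homotopic.
- move=> phi psi [a1 ha1 hphi] [a2 ha2 hpsi].
  (* two elements of the space have a common norm, that of the smaller base *)
  have a1' : 1 < Num.min a1 a2 by rewrite lt_min ha1.
  have [b _ hb] := dom _ a1'; eexists; eexists; split; first exact: hb.
    apply: le_lt_trans hphi; apply: le_weighted => x.
    rewrite ge0_ler_powR ?nnegrE ?ge_min ?lexx ?mdist_ge0// ltW//.
      by rewrite (lt_trans ltr01).
    by rewrite (lt_trans ltr01).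
  apply: le_lt_trans hpsi; apply: le_weighted => x.
  rewrite ge0_ler_powR ?nnegrE ?ge_min ?lexx ?orbT ?mdist_ge0// ltW//.
    by rewrite (lt_trans ltr01).
  by rewrite (lt_trans ltr01).
- move=> phi psi [a a1 hphi] h; have [b b1 hb] := dom _ a1.
  by exists b => //; exact: uniformly_dominated1 h hb hphi.
- move=> P Q [a a1 hP] h; have [b b1 hb] := dom _ a1.
  by exists b => //; exact: uniformly_dominated_bounded h hb hP.
Qed.

Lemma contractible_Oexp : exp_growth star f ->
  contractible (redTC (Oexp star)).
Proof.
move=> [C [a [C0 a1 hC]]]; have [D D0 hD] := dominates_exp hcomb.
have dom b : 1 < b -> exists2 c, 1 < c &
    dominates f (fun x => c `^ len star x) (fun x => b `^ len star x).
  move=> b1; exists (b `^ D * a); last exact: hD (ltW C0) a1 b1 hC.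
  by rewrite (lt_le_trans a1)// ler_peMl ?powR_ge1// ltW// (lt_trans ltr01).
apply: combing_null_homotopic.
- move=> phi psi hphi hpsi; have [c c1 hc] := dom 2 (ltr1n _ 2).
  by eexists; eexists; split; [exact: hc|exact: hphi|exact: hpsi].
- move=> phi psi hphi h b b1; have [c c1 hc] := dom b b1.
  exact: uniformly_dominated1 h hc (hphi c c1).
- move=> P Q hP h b b1; have [c c1 hc] := dom b b1.
  exact: uniformly_dominated_bounded h hc (hP c c1).
Qed.

End Instances.

Theorem theorem5 (R : realType) (X : metricType R) (star : X)
    (hdiscrete : discrete_metric X) (hproper : proper_metric X) :
  [/\ forall m : nat,
        (exists f, combing star f /\ poly_growth star m f) ->
        forall k : R, 0 <= k ->
          null_homotopic (redTC (Spol star (k + m%:R))) (redTC (Spol star k))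
            embedding,
      (exists m f, combing star f /\ poly_growth star m f) ->
        contractible (redTC (Sinfty star)),
      (exists f, combing star f /\ subexp_growth star f) ->
        contractible (redTC (Somega star)) &
      (exists f, combing star f /\ exp_growth star f) ->
        contractible (redTC (Oexp star))].
Proof.
split.
- by move=> m [f [hcomb hm]] k k0; exact: (null_homotopic_Spol hproper hcomb hm).
- by move=> [m [f [hcomb hm]]]; exact: (contractible_Sinfty hproper hcomb hm).
- by move=> [f [hcomb hf]]; exact: (contractible_Somega hproper hcomb).
- by move=> [f [hcomb hf]]; exact: (contractible_Oexp hproper hcomb).
Qed.
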